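(* Let $\mathfrak{g}$ be the complex vector space with basis $X_1,X_2,Y_1,Y_2,Y_3,Y_4,Z_1,Z_2$, with the bilinear antisymmetric bracket whose only non-vanishing commutators of basis elements (up to antisymmetry) are $$[X_1,Y_2]=Y_3,\quad [X_2,Y_1]=Y_3+Z_2,\quad [X_2,Y_2]=Y_4,\quad [X_2,Z_2]=Z_1.$$ Then $\mathfrak{g}$ is a $3$-step nilpotent Lie algebra, and $\mathfrak{h}=\langle X_1,X_2\rangle_{\mathbb{C}}$ and $\mathfrak{v}=\langle X_1+Z_1,X_2+Z_2\rangle_{\mathbb{C}}$ are subalgebras of $\mathfrak{g}$. Let $G$ be the connected, simply connected complex unipotent Lie group with Lie algebra $\mathfrak{g}$, and let $V=\exp\mathfrak{v}$, $H=\exp\mathfrak{h}$. Then the $V\times H$-action on $G$ given by $(v,h).g=vgh^{-1}$ is free and proper, but its geometric quotient $V\backslash G/H$ is not affine, and the action does not have a global (holomorphic or algebraic) slice.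
   Context: The descending central series is $\mathfrak{g}^{(0)}=\mathfrak{g}$, $\mathfrak{g}^{(j+1)}=[\mathfrak{g},\mathfrak{g}^{(j)}]$; $\mathfrak{g}$ is $l$-step nilpotent if $l$ is the smallest integer with $\mathfrak{g}^{(l)}=\{0\}$. An action of a Lie group $L$ on $X$ is proper if the map $L\times X\to X\times X$, $(g,x)\mapsto(x,g.x)$, is proper (in the Euclidean topology). A global algebraic (respectively holomorphic) slice of the $V\times H$-action on $G$ is a closed algebraic subvariety (respectively closed complex submanifold) $S\subset G$ such that $V\times S\times H\to G$, $(v,s,h)\mapsto vsh$, is an isomorphism of algebraic varieties (respectively biholomorphic). *)

(* Defs.v *)
From HB Require Import structures.
From mathcomp Require Import all_boot all_order all_algebra.
From mathcomp Require Import complex ring.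
From mathcomp Require Import all_classical all_reals all_analysis.
From mathcomp Require mpoly.

Set Implicit Arguments.
Unset Strict Implicit.
Unset Printing Implicit Defensive.

Import Order.TTheory GRing.Theory Num.Theory numFieldNormedType.Exports.
Local Open Scope classical_set_scope.
Local Open Scope ring_scope.

(* Naming the carrier as a numClosedFieldType (rather than writing R[i]) lets
   the norm and the Euclidean topology of 'rV[Cplx R]_n be inferred. *)
Definition Cplx (R : realType) : numClosedFieldType := R[i].

Section LieAlgebras.
Variables (K : fieldType) (g : vectType K) (br : g -> g -> g).

Record is_lie_bracket : Prop := IsLieBracket {
  lie_linl : forall a x y z, br (a *: x + y) z = a *: br x z + br y z;
  lie_linr : forall a x y z, br z (a *: x + y) = a *: br z x + br z y;
  lie_alt : forall x, br x x = 0;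
  lie_jacobi : forall x y z, br x (br y z) + br y (br z x) + br z (br x y) = 0
}.

(* For bilinear br this is the span of all br u w with u \in U and w \in W;
   compare prodv in falgebra. *)
Definition lie_comm (U W : {vspace g}) : {vspace g} :=
  <<[seq br u w | u <- vbasis U, w <- vbasis W]>>%VS.

Definition lcs (j : nat) : {vspace g} := iter j (lie_comm fullv) fullv.

Definition nilpotent_step (l : nat) : Prop :=
  lcs l = 0%VS /\ forall j, (j < l)%N -> lcs j <> 0%VS.

Definition is_subalgebra (U : {vspace g}) : Prop :=
  forall x y, x \in U -> y \in U -> br x y \in U.

End LieAlgebras.

Section Actions.

Definition free_action (A X : Type) (L : set A) (e : A) (act : A -> X -> X) :=
  forall l x, L l -> act l x = x -> l = e.

(* Properness of L * X -> X * X, (l, x) |-> (x, l.x): preimages of compact sets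
   are compact. *)
Definition proper_action (A X : topologicalType) (L : set A)
    (act : A -> X -> X) :=
  forall K : set (X * X), compact K ->
    compact [set p : A * X | L p.1 /\ K (p.2, act p.1 p.2)].

End Actions.

(* Algebraic varieties as spaces with functions.  A space is carried by the
   subset dom of pt; functions are total on pt, and only their values on the
   open set under consideration matter. *)
Section Varieties.
Variable K : closedFieldType.

Record funspace := Funspace {
  pt : Type;
  dom : set pt;
  opn : set (set pt);
  reg : set pt -> set (pt -> K)
}.

Arguments dom : clear implicits.
Arguments opn : clear implicits.
Arguments reg : clear implicits.

Record is_space (X : funspace) : Prop := IsSpace {
  opn_sub : forall U, opn X U -> U `<=` dom X;
  opn_dom : opn X (dom X);
  opn_setI : forall U W, opn X U -> opn X W -> opn X (U `&` W);
  opn_bigcup : forall F : set (set (pt X)),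
    F `<=` opn X -> opn X (\bigcup_(U in F) U);
  reg_ext : forall U f f', opn X U -> (forall x, U x -> f x = f' x) ->
    reg X U f -> reg X U f';
  reg_local : forall (F : set (set (pt X))) f, F `<=` opn X ->
    (reg X (\bigcup_(U in F) U) f <-> forall U, F U -> reg X U f)
}.

Definition restrict (X : funspace) (U : set (pt X)) : funspace :=
  Funspace U [set W | opn X W /\ W `<=` U] (reg X).

Definition morphism (X Y : funspace) (f : pt X -> pt Y) : Prop :=
  [/\ forall x, dom X x -> dom Y (f x),
      forall W, opn Y W -> opn X (dom X `&` f @^-1` W) &
      forall W h, opn Y W -> reg Y W h -> reg X (dom X `&` f @^-1` W) (h \o f)].

Definition isomorphism (X Y : funspace) (f : pt X -> pt Y) : Prop :=
  morphism f /\ exists g : pt Y -> pt X,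
    [/\ morphism g, forall x, dom X x -> g (f x) = x &
        forall y, dom Y y -> f (g y) = y].

Definition peval n (p : mpoly.mpoly n K) (x : 'rV[K]_n) : K :=
  mpoly.meval (x 0) p.

Definition zclosed n (Z : set 'rV[K]_n) : Prop :=
  exists I : set (mpoly.mpoly n K),
    Z = [set x | forall p, I p -> peval p x = 0].

Definition zopen n (U : set 'rV[K]_n) : Prop := zclosed (~` U).

(* Z with the induced Zariski topology and the functions that are locally
   quotients of polynomials. *)
Definition zariski n (Z : set 'rV[K]_n) : funspace :=
  Funspace Z
    [set U | exists2 O, zopen O & U = Z `&` O]
    (fun U => [set f | forall x, U x -> exists O p q,
       [/\ zopen O, O x &
           forall y, U y -> O y -> peval q y != 0 /\ f y = peval p y / peval q y]]).

Definition affine (X : funspace) : Prop :=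
  exists n (Z : set 'rV[K]_n), zclosed Z /\
    exists f : pt X -> pt (zariski Z), isomorphism f.

(* Since products of affine varieties are affine, testing on affine sources
   amounts to closedness of the diagonal. *)
Definition separated (X : funspace) : Prop :=
  forall n (Z : set 'rV[K]_n) (f g : pt (zariski Z) -> pt X),
    zclosed Z -> morphism f -> morphism g ->
    zclosed [set z | Z z /\ f z = g z].

(* Not assumed irreducible. *)
Definition variety (X : funspace) : Prop :=
  [/\ is_space X,
      exists k (U : 'I_k -> set (pt X)),
        [/\ forall i, opn X (U i), dom X = \bigcup_i U i &
            forall i, affine (restrict (U i))] &
      separated X].

(* Y is a geometric quotient of X by L: the fibres of pi are the orbits, Y has
   the quotient topology, and O_Y is the sheaf of invariant functions. *)
Record geometric_quotient (A : Type) (X : funspace) (L : set A)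
    (act : A -> pt X -> pt X) (Y : funspace) (pi : pt X -> pt Y) : Prop :=
  GeometricQuotient {
  gq_variety : variety Y;
  gq_morphism : morphism pi;
  gq_surj : forall y, dom Y y -> exists2 x, dom X x & pi x = y;
  gq_fibre : forall x x', dom X x -> dom X x' ->
    (pi x = pi x' <-> exists2 l, L l & act l x = x');
  gq_open : forall W, W `<=` dom Y ->
    (opn Y W <-> opn X (dom X `&` pi @^-1` W));
  gq_fun : forall W phi, opn Y W -> reg X (dom X `&` pi @^-1` W) phi ->
    (forall l x, L l -> (dom X `&` pi @^-1` W) x -> phi (act l x) = phi x) ->
    exists2 f, reg Y W f & forall x, (dom X `&` pi @^-1` W) x -> phi x = f (pi x)
}.

End Varieties.

Section ComplexManifolds.
Variable R : realType.
Local Notation C := (Cplx R).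

(* Holomorphic maps on subsets of C^m: local restrictions of maps which are
   complex differentiable on an open set.  On embedded submanifolds these are
   the holomorphic maps. *)
Definition holomorphic m n (A : set 'rV[C]_m)
    (f : 'rV[C]_m -> 'rV[C]_n) : Prop :=
  forall x, A x -> exists (U : set 'rV[C]_m) (F : 'rV[C]_m -> 'rV[C]_n),
    [/\ open U, U x, forall y, U y -> differentiable F y &
        forall y, A y -> U y -> f y = F y].

Definition biholomorphic m n (A : set 'rV[C]_m) (B : set 'rV[C]_n)
    (f : 'rV[C]_m -> 'rV[C]_n) : Prop :=
  [/\ forall x, A x -> B (f x), holomorphic A f &
      exists g : 'rV[C]_n -> 'rV[C]_m,
        [/\ forall y, B y -> A (g y), holomorphic B g,
            forall x, A x -> g (f x) = x & forall y, B y -> f (g y) = y]].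

(* Near each point, some holomorphic chart phi of the ambient space maps S to
   the coordinate subspace where all coordinates of index >= k vanish. *)
Definition submanifold n (S : set 'rV[C]_n) : Prop :=
  forall x, S x -> exists (k : nat) (U W : set 'rV[C]_n) phi,
    [/\ open U, U x, open W, biholomorphic U W phi &
        forall y, U y -> (S y <-> forall i : 'I_n, (k <= i)%N -> phi y 0 i = 0)].

End ComplexManifolds.

Section Example.
Variable C : numClosedFieldType.
Local Notation g := 'rV[C]_8.

Definition iX1 : 'I_8 := @Ordinal 8 0 isT.
Definition iX2 : 'I_8 := @Ordinal 8 1 isT.
Definition iY1 : 'I_8 := @Ordinal 8 2 isT.
Definition iY2 : 'I_8 := @Ordinal 8 3 isT.
Definition iY3 : 'I_8 := @Ordinal 8 4 isT.
Definition iY4 : 'I_8 := @Ordinal 8 5 isT.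
Definition iZ1 : 'I_8 := @Ordinal 8 6 isT.
Definition iZ2 : 'I_8 := @Ordinal 8 7 isT.

Definition vec (i : 'I_8) : g := delta_mx 0 i.

Definition wedge (i j : 'I_8) (x y : g) : C := x 0 i * y 0 j - x 0 j * y 0 i.

(* The term wedge i j x y *: w is the contribution of [e_i, e_j] = w. *)
Definition br (x y : g) : g :=
  wedge iX1 iY2 x y *: vec iY3 +
  wedge iX2 iY1 x y *: (vec iY3 + vec iZ2) +
  wedge iX2 iY2 x y *: vec iY4 +
  wedge iX2 iZ2 x y *: vec iZ1.

Definition hh : {vspace g} := <<[:: vec iX1; vec iX2]>>%VS.
Definition vv : {vspace g} :=
  <<[:: (vec iX1 + vec iZ1)%R; (vec iX2 + vec iZ2)%R]>>%VS.

(* The connected, simply connected group G with Lie algebra g, in exponential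
   coordinates: the underlying manifold (and variety) of G is g, exp is the
   identity map, and the product is given by the Baker-Campbell-Hausdorff
   formula, which stops at brackets of length 3 as g is 3-step nilpotent. *)
Definition gmul (x y : g) : g :=
  x + y + 2^-1 *: br x y + 12^-1 *: (br x (br x y) + br y (br y x)).

Definition gone : g := 0.

Definition ginv (x : g) : g := - x.

Definition gexp (x : g) : g := x.

Definition Vgrp : set g := [set gexp x | x in [set x | x \in vv]].
Definition Hgrp : set g := [set gexp x | x in [set x | x \in hh]].

Definition VH : set (g * g) := Vgrp `*` Hgrp.

Definition act (l : g * g) (x : g) : g := gmul (gmul l.1 x) (ginv l.2).

Lemma brE (x y : g) i : br x y 0 i =
  if i == iY3 then wedge iX1 iY2 x y + wedge iX2 iY1 x y
  else if i == iZ2 then wedge iX2 iY1 x y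
  else if i == iY4 then wedge iX2 iY2 x y
  else if i == iZ1 then wedge iX2 iZ2 x y
  else 0.
Proof.
rewrite /br !mxE /=; case: i => [[|[|[|[|[|[|[|[|//]]]]]]]] hi] /=; ring.
Qed.

Lemma gmulE (x y : g) i : gmul x y 0 i = x 0 i + y 0 i +
  (if i == iY3 then 2^-1 * (wedge iX1 iY2 x y + wedge iX2 iY1 x y)
   else if i == iZ2 then 2^-1 * wedge iX2 iY1 x y
   else if i == iY4 then 2^-1 * wedge iX2 iY2 x y
   else if i == iZ1 then 2^-1 * wedge iX2 iZ2 x y +
     12^-1 * ((x 0 iX2 - y 0 iX2) * wedge iX2 iY1 x y)
   else 0).
Proof.
rewrite /gmul; set b := br x y; set c := br y x.
have -> : (x + y + 2^-1 *: b + 12^-1 *: (br x b + br y c)) 0 i =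
  x 0 i + y 0 i + 2^-1 * b 0 i + 12^-1 * (br x b 0 i + br y c 0 i).
  by rewrite !mxE.
rewrite !brE /wedge !brE /wedge.
case: i => [[|[|[|[|[|[|[|[|//]]]]]]]] hi] /=; ring.
Qed.

Lemma gmulA (x y z : g) : gmul x (gmul y z) = gmul (gmul x y) z.
Proof.
apply/rowP => i; rewrite !gmulE /wedge !gmulE /wedge.
case: i => [[|[|[|[|[|[|[|[|//]]]]]]]] hi] /=; try ring.
by field.
Qed.

Lemma gmul1x (x : g) : gmul gone x = x.
Proof.
apply/rowP => i; rewrite gmulE /wedge /gone !mxE.
by case: i => [[|[|[|[|[|[|[|[|//]]]]]]]] hi] /=; ring.
Qed.

Lemma gmulVx (x : g) : gmul (ginv x) x = gone.
Proof.
apply/rowP => i; rewrite gmulE /wedge /gone /ginv !mxE.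
by case: i => [[|[|[|[|[|[|[|[|//]]]]]]]] hi] /=; ring.
Qed.

End Example.

Arguments Vgrp : clear implicits.
Arguments Hgrp : clear implicits.
Arguments VH : clear implicits.
Arguments br {C}.
Arguments act {C}.

Section Slices.
Variable R : realType.
Local Notation C := (Cplx R).
Local Notation g := 'rV[C]_8.

Definition Gvar : funspace C := zariski [set: g].

(* Triples (v, s, h) are concatenated into points of C^24. *)
Definition VSH (S : set g) : set 'rV[C]_(8 + 8 + 8) :=
  [set p | [/\ Vgrp C (lsubmx (lsubmx p)), S (rsubmx (lsubmx p)) & Hgrp C (rsubmx p)]].

Definition vsh (p : 'rV[C]_(8 + 8 + 8)) : g :=
  gmul (gmul (lsubmx (lsubmx p)) (rsubmx (lsubmx p))) (rsubmx p).

Definition algebraic_slice (S : set g) : Prop :=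
  zclosed S /\ @isomorphism C (zariski (VSH S)) Gvar vsh.

Definition holomorphic_slice (S : set g) : Prop :=
  [/\ closed S, submanifold S & biholomorphic (VSH S) [set: g] vsh].

End Slices.

(* Main.v *)
(* Every x in G is n exp(x_1 X_1 + x_2 X_2) with n in the abelian ideal spanned by
   the Y_i and Z_i, and the orbit of x is determined by the V-orbit of n. The
   element of V x H carrying x to x' is a polynomial in (x, x'), which gives freeness
   and properness. The invariants t = y_1 + 1, s = y_2, p, q, r identify the quotient
   with the quadric t r - s q = p (2 - p) / 2 minus the locus t = s = 0, p = 2, which
   has codimension two. An affine quotient, or a slice, would yield an invariant
   holomorphic map F from G to a closed subset of some C^n, through which t, s and p
   factor. On orbits approaching the missing point t = s = q = r = 0, p = 2 within
   the surface q = r = 0, p = 2, the map F stays bounded by the maximum principle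
   in t, so it has a cluster value F(x) there, and x would satisfy t = s = 0, p = 2,
   which is impossible on G. The maximum principle is only needed up to a constant and for
   pointwise differentiability; it is obtained from Goursat's argument for trapezoidal
   sums. *)
From HB Require Import structures.
From mathcomp Require Import all_boot all_order all_algebra.
From mathcomp Require Import complex ring lra.
From mathcomp Require Import all_classical all_reals all_analysis.
From mathcomp Require mpoly.
Import (canonicals, coercions) mpoly.
Require Import Defs.

Set Implicit Arguments.
Unset Strict Implicit.
Unset Printing Implicit Defensive.

Import Order.TTheory GRing.Theory Num.Theory numFieldNormedType.Exports.
Local Open Scope classical_set_scope.
Local Open Scope ring_scope.

(** * Goursat's lemma and a Cauchy estimate for trapezoidal sums *)

Section Trapezoid.
Variable K : numFieldType.
Implicit Types (f : K -> K) (a b c : K).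

(** The missing locus is harmful because of Hartogs' phenomenon: it has codimension two, so
    invariant holomorphic functions stay bounded near it although no orbit lies over it. To use a
    single complex variable, t runs over a square around 0 at fixed s ≠ 0, and each orbit gets two
    representatives: one is continuous down to s = 0 but has a pole at t = 0, the other is affine in
    t but has a pole at s = 0. Integrals are replaced by trapezoidal sums of depth n, for which the
    subdivision of a triangle is an exact identity shifting n by one. Limits of these sums are never
    taken; bounds for all large n suffice. Affine quotients and slices are treated alike: the image
    of F is closed and hence contains the cluster value, and the regular functions expressing t, s
    and p in terms of F are continuous there. *)

Definition mid a b : K := (a + b) / 2.

(* The trapezoidal sum for the integral of f from a to b with 2 ^ n steps. *)
Fixpoint trap f n a b : K :=
  if n is m.+1 then trap f m a (mid a b) + trap f m (mid a b) b
  else (f a + f b) / 2 * (b - a).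

Definition tri f n a b c : K := trap f n a b + trap f n b c + trap f n c a.

Lemma midC a b : mid a b = mid b a.
Proof. by rewrite /mid addrC. Qed.

Lemma trapN f n a b : trap f n b a = - trap f n a b.
Proof.
elim: n a b => [|n IH] a b /=; first by ring.
by rewrite midC (IH a) (IH (mid a b)); ring.
Qed.

Lemma trap_sub f g k n a b :
  trap (fun z => f z - k * g z) n a b = trap f n a b - k * trap g n a b.
Proof.
elim: n a b => [|n IH] a b /=; first by ring.
by rewrite !IH; ring.
Qed.

(** The trapezoidal rule is exact for affine integrands at every depth, so the linear part of a
    function contributes nothing around a closed triangle. *)
Lemma trap_affine al be n a b :
  trap (fun z => al + be * z) n a b = al * (b - a) + be * (b ^+ 2 - a ^+ 2) / 2.
Proof.
elim: n a b => [|n IH] a b /=; first by field.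
by rewrite !IH /mid; field.
Qed.

(** Substitution rule; with [k] a power of the imaginary unit it rotates one quarter of a square
    onto another. *)
Lemma trap_scale f k n a b :
  trap (fun z => f (k * z)) n a b * k = trap f n (k * a) (k * b).
Proof.
elim: n a b => [|n IH] a b /=; first by field.
have -> : mid (k * a) (k * b) = k * mid a b by rewrite /mid; ring.
by rewrite -!IH; ring.
Qed.

Lemma eq_trap f g n a b : f =1 g -> trap f n a b = trap g n a b.
Proof. by move=> /funext ->. Qed.

(** Each inner edge is traversed twice in opposite directions and cancels; each outer edge of depth
    n + 1 is by definition the sum of its halves at depth n. *)
Lemma tri_split f n a b c : tri f n.+1 a b c =
  tri f n a (mid a b) (mid c a) + tri f n (mid a b) b (mid b c) +
  tri f n (mid c a) (mid b c) c + tri f n (mid a b) (mid b c) (mid c a).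
Proof.
rewrite /tri /= (trapN f n (mid a b) (mid c a)).
by rewrite (trapN f n (mid a b) (mid b c)) (trapN f n (mid c a) (mid b c)); ring.
Qed.

End Trapezoid.

(** * The real-valued modulus of a complex number *)

Section Modulus.
Variable R : realType.
Local Notation C := (Cplx R).
Implicit Types (z w : C).

(* The norm of Cplx R takes its values in Cplx R; nc takes them in R, which is
   totally ordered. *)
Definition nc z : R := ComplexField.Normc.normc z.
Definition re z : R := complex.Re z.
Definition im z : R := complex.Im z.

Lemma normE z : `|z| = (real_complex R (nc z)).
Proof. by []. Qed.

Lemma nc_ge0 z : 0 <= nc z.
Proof. by have := normr_ge0 z; rewrite normE ler0c. Qed.

Lemma ncD z w : nc (z + w) <= nc z + nc w.
Proof. exact: le_normcD. Qed.

Lemma ncM z w : nc (z * w) = nc z * nc w.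
Proof. exact: ComplexField.Normc.normcM. Qed.

Lemma ncN z : nc (- z) = nc z.
Proof. exact: normcN. Qed.

Lemma ncBC z w : nc (z - w) = nc (w - z).
Proof. by rewrite -ncN opprB. Qed.

Lemma ncV z : nc z^-1 = (nc z)^-1.
Proof. exact: ComplexField.Normc.normcV. Qed.

Lemma nc0 : nc 0 = 0.
Proof. exact: ComplexField.Normc.normc0. Qed.

Lemma nc_eq0 z : (nc z == 0) = (z == 0).
Proof. by apply/eqP/eqP => [/ComplexField.Normc.eq0_normc|->]; rewrite ?nc0. Qed.

Lemma nc_gt0 z : (0 < nc z) = (z != 0).
Proof. by rewrite lt0r nc_eq0 nc_ge0 andbT. Qed.

Lemma nc2 : nc 2 = 2.
Proof. by rewrite /nc /= addr0 expr0n /= addr0 sqrtr_sqr ger0_norm. Qed.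

Lemma nc_half z : nc (z / 2) = nc z / 2.
Proof. by rewrite ncM ncV nc2. Qed.

Lemma re_le_nc z : `|re z| <= nc z.
Proof. by have := normc_ge_Re z; rewrite normE lecR. Qed.

Lemma im_le_nc z : `|im z| <= nc z.
Proof.
rewrite /im /nc; case: z => x y /=.
by rewrite -sqrtr_sqr ler_wsqrtr // lerDr sqr_ge0.
Qed.

Lemma nc_le_reim z : nc z <= `|re z| + `|im z|.
Proof.
rewrite /re /im /nc; case: z => x y /=.
rewrite -(ger0_norm (addr_ge0 (normr_ge0 x) (normr_ge0 y))) -sqrtr_sqr.
apply: ler_wsqrtr; rewrite sqrrD !real_normK ?num_real //.
by rewrite -addrA lerD2l lerDr mulrn_wge0 // mulr_ge0.
Qed.

Lemma reD z w : re (z + w) = re z + re w. Proof. by case: z w => [? ?] []. Qed.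
Lemma imD z w : im (z + w) = im z + im w. Proof. by case: z w => [? ?] []. Qed.
Lemma reN z : re (- z) = - re z. Proof. by case: z. Qed.
Lemma imN z : im (- z) = - im z. Proof. by case: z. Qed.
Lemma reM z w : re (z * w) = re z * re w - im z * im w.
Proof. by case: z w => [? ?] []. Qed.
Lemma imM z w : im (z * w) = re z * im w + im z * re w.
Proof. by case: z w => [? ?] []. Qed.

Lemma half_def : 2^-1 = real_complex R 2^-1 :> C.
Proof. by rewrite fmorphV rmorph_nat. Qed.

Lemma re_mid z w : re (mid z w) = (re z + re w) / 2.
Proof. by rewrite /mid half_def reM reD /= mulr0 subr0. Qed.
Lemma im_mid z w : im (mid z w) = (im z + im w) / 2.
Proof. by rewrite /mid half_def imM imD /= mulr0 add0r. Qed.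

End Modulus.

(** The intervals with centre [x n] and radius 2p/2^n, the tail of the geometric series, are nested;
    the limit is the supremum of their left ends. *)
Lemma geometric_cauchy_limit (R : realType) (x : nat -> R) (p : R) :
  (forall n, `|x n.+1 - x n| <= p / 2 ^+ n) ->
  exists l, forall n, `|x n - l| <= 2 * p / 2 ^+ n.
Proof.
move=> hx.
have p0 : 0 <= p by have := hx 0; rewrite expr0 divr1; apply: le_trans.
pose u n := x n - 2 * p / 2 ^+ n; pose v n := x n + 2 * p / 2 ^+ n.
have e2 n : 2 * p / 2 ^+ n.+1 = p / 2 ^+ n.
  by rewrite exprS invfM mulrA -[2 * p * _]mulrA [p / 2]mulrC mulrA divff ?mul1r.
have e2' n : 2 * p / 2 ^+ n = 2 * (p / 2 ^+ n) by rewrite mulrA.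
have uS n : u n <= u n.+1.
  by rewrite /u e2 e2'; have := hx n; rewrite ler_norml => /andP[]; lra.
have vS n : v n.+1 <= v n.
  by rewrite /v e2 e2'; have := hx n; rewrite ler_norml => /andP[]; lra.
have um m n : u m <= u (m + n)%N.
  elim: n => [|n IH]; rewrite ?addn0 // addnS; exact: le_trans IH (uS _).
have vm m n : v (m + n)%N <= v m.
  elim: n => [|n IH]; rewrite ?addn0 // addnS; exact: le_trans (vS _) IH.
have uv n : u n <= v n.
  have := mulr_ge0 p0 (ltW (exprn_gt0 n (_ : 0 < 2^-1 :> R))).
  by rewrite exprVn invr_gt0 ltr0n /u /v e2' => /(_ isT); lra.
have uvm m n : u m <= v n.
  apply: le_trans (um m n) _; apply: le_trans (uv _) _; rewrite addnC; exact: vm.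
have hs : has_sup (range u).
  by split; [exists (u 0); exists 0|exists (v 0) => _ [n _ <-]; exact: uvm].
exists (sup (range u)) => n.
have h1 : u n <= sup (range u) by apply: sup_upper_bound => //; exists n.
have h2 : sup (range u) <= v n.
  by apply: ge_sup => [|_ [m _ <-]]; [exists (u 0); exists 0|exact: uvm].
by rewrite ler_norml; move: h1 h2; rewrite /u /v => *; apply/andP; split; lra.
Qed.

(** * Goursat's bisection argument *)

Section Goursat.
Variable R : realType.
Local Notation C := (Cplx R).
Implicit Types (f : C -> C) (z w a b c : C) (P : C -> Prop).

Lemma complex_geometric_limit (x : nat -> C) (p : R) :
  (forall n, nc (x n.+1 - x n) <= p / 2 ^+ n) ->
  exists l, forall n, nc (x n - l) <= 4 * p / 2 ^+ n.
Proof.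
move=> hx.
have [r hr] : exists r, forall n, `|re (x n) - r| <= 2 * p / 2 ^+ n.
  by apply: geometric_cauchy_limit => n; rewrite -reN -reD; exact: le_trans (re_le_nc _) (hx n).
have [s hs] : exists s, forall n, `|im (x n) - s| <= 2 * p / 2 ^+ n.
  by apply: geometric_cauchy_limit => n; rewrite -imN -imD; exact: le_trans (im_le_nc _) (hx n).
exists (r +i* s)%C => n; apply: le_trans (nc_le_reim _) _.
by rewrite reD imD reN imN /=; have := hr n; have := hs n; rewrite -!mulrA; lra.
Qed.

(** Complex differentiability with real epsilon and delta, and without a quotient, so that w = z
    needs no exception. *)
Definition cdiff f z := exists al, forall e : R, 0 < e -> exists2 d : R, 0 < d &
  forall w, nc (w - z) < d -> nc (f w - f z - al * (w - z)) <= e * nc (w - z).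

(** Stands in for convexity: [trap] evaluates its integrand only at iterated midpoints of the end
    points. *)
Definition midclosed P := forall a b, P a -> P b -> P (mid a b).

Lemma mid_subl a b : mid a b - a = (b - a) / 2.
Proof. by rewrite /mid; field. Qed.

Lemma mid_subr a b : b - mid a b = (b - a) / 2.
Proof. by rewrite /mid; field. Qed.

Lemma mid_mid a b c : mid b c - mid a b = (c - a) / 2.
Proof. by rewrite /mid; ring. Qed.

Lemma midclosed_ball l (r : R) : midclosed (fun z => nc (z - l) <= r).
Proof.
move=> a b ha hb; have -> : mid a b - l = (a - l) / 2 + (b - l) / 2.
  by rewrite /mid; field.
by apply: le_trans (ncD _ _) _; rewrite !nc_half; lra.
Qed.

Lemma trap_bound P f (M : R) n a b : midclosed P ->
  (forall z, P z -> nc (f z) <= M) -> P a -> P b ->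
  nc (trap f n a b) <= M * nc (b - a).
Proof.
move=> hP hM; elim: n a b => [|n IH] a b Pa Pb /=.
  rewrite ncM; apply: ler_wpM2r; first exact: nc_ge0.
  rewrite nc_half; have := ncD (f a) (f b); have := hM _ Pa; have := hM _ Pb; lra.
have Pm := hP _ _ Pa Pb; apply: le_trans (ncD _ _) _.
have := IH _ _ Pa Pm; have := IH _ _ Pm Pb.
by rewrite mid_subl mid_subr nc_half; lra.
Qed.

Definition per a b c : R := nc (b - a) + nc (c - b) + nc (a - c).

Lemma per_ge0 a b c : 0 <= per a b c.
Proof. by rewrite /per !addr_ge0 ?nc_ge0. Qed.

Lemma le_perl a b c : nc (b - a) <= per a b c.
Proof. by rewrite /per -addrA lerDl addr_ge0 ?nc_ge0. Qed.

Lemma le_perr a b c : nc (c - a) <= per a b c.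
Proof. by rewrite /per (ncBC c a) lerDr addr_ge0 ?nc_ge0. Qed.

Lemma tri_bound P f (M : R) n a b c : midclosed P ->
  (forall z, P z -> nc (f z) <= M) -> P a -> P b -> P c ->
  nc (tri f n a b c) <= M * per a b c.
Proof.
move=> hP hM Pa Pb Pc; rewrite /tri /per !mulrDr.
apply: le_trans (ncD _ _) _; apply: lerD; last exact: (trap_bound _ hP).
by apply: le_trans (ncD _ _) _; apply: lerD; exact: (trap_bound _ hP).
Qed.

Lemma tri_sub_affine f l al n a b c :
  tri (fun z => f z - f l - al * (z - l)) n a b c = tri f n a b c.
Proof.
have h u v : trap (fun z => f z - f l - al * (z - l)) n u v =
    trap f n u v - ((f l - al * l) * (v - u) + al * (v ^+ 2 - u ^+ 2) / 2).
  rewrite -(trap_affine _ _ n) -[X in _ - X]mul1r -trap_sub.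
  by apply: eq_trap => z; ring.
by rewrite /tri !h; field.
Qed.

(** The bound is quadratic in the perimeter, so that the bounds for four triangles of half the
    perimeter add up to the bound for the whole. The threshold [K] may depend on the triangle. *)
Definition tri_small f (e : R) a b c :=
  exists K, forall n, (K <= n)%N -> nc (tri f n a b c) <= e * per a b c ^+ 2.

(** The second clause makes the first vertices of nested triangles a Cauchy sequence; the third
    keeps all vertices in the half plane where the function is differentiable. *)
Definition subtri a b c a' b' c' := [/\ per a' b' c' = per a b c / 2,
  nc (a' - a) <= per a b c &
  forall P, midclosed P -> P a -> P b -> P c -> [/\ P a', P b' & P c']].

Lemma subtri_vertexl a b c : subtri a b c a (mid a b) (mid c a).
Proof.
split.
- rewrite /per mid_subl mid_subr.
  have -> : mid c a - mid a b = (c - b) / 2 by rewrite /mid; field.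
  by rewrite !nc_half; field.
- by rewrite subrr nc0 per_ge0.
- by move=> P hP Pa Pb Pc; split => //; exact: hP.
Qed.

Lemma subtri_vertexm a b c : subtri a b c (mid a b) b (mid b c).
Proof.
split.
- rewrite /per mid_subr mid_subl.
  have -> : mid a b - mid b c = (a - c) / 2 by rewrite /mid; field.
  by rewrite !nc_half; field.
- rewrite mid_subl nc_half /per; have := nc_ge0 (b - a).
  by have := nc_ge0 (c - b); have := nc_ge0 (a - c); lra.
- by move=> P hP Pa Pb Pc; split => //; exact: hP.
Qed.

Lemma subtri_vertexr a b c : subtri a b c (mid c a) (mid b c) c.
Proof.
split.
- rewrite /per mid_subr mid_subl.
  have -> : mid b c - mid c a = (b - a) / 2 by rewrite /mid; field.
  by rewrite !nc_half; field.
- rewrite midC mid_subl nc_half /per ncBC; have := nc_ge0 (b - a).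
  by have := nc_ge0 (c - b); have := nc_ge0 (a - c); lra.
- by move=> P hP Pa Pb Pc; split => //; exact: hP.
Qed.

Lemma subtri_middle a b c : subtri a b c (mid a b) (mid b c) (mid c a).
Proof.
split.
- by rewrite /per !mid_mid !nc_half (ncBC c a) (ncBC a b) (ncBC b c); field.
- rewrite mid_subl nc_half /per; have := nc_ge0 (b - a).
  by have := nc_ge0 (c - b); have := nc_ge0 (a - c); lra.
- by move=> P hP Pa Pb Pc; split; exact: hP.
Qed.

Lemma tri_small_split f (e : R) a b c :
  (forall a' b' c', subtri a b c a' b' c' -> tri_small f e a' b' c') ->
  tri_small f e a b c.
Proof.
move=> h.
have [K1 h1] := h _ _ _ (subtri_vertexl a b c).
have [K2 h2] := h _ _ _ (subtri_vertexm a b c).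
have [K3 h3] := h _ _ _ (subtri_vertexr a b c).
have [K4 h4] := h _ _ _ (subtri_middle a b c).
(* The sum dominates the four thresholds, and the successor pays for the depth lost in
   [tri_split]. *)
exists (K1 + K2 + K3 + K4).+1 => -[//|n]; rewrite ltnS => hn; rewrite tri_split.
have /h1 {}h1 : (K1 <= n)%N by apply: leq_trans hn; rewrite -!addnA leq_addr.
have /h2 {}h2 : (K2 <= n)%N.
  by apply: leq_trans hn; rewrite -!addnA addnCA leq_addr.
have /h3 {}h3 : (K3 <= n)%N.
  by apply: leq_trans hn; rewrite -addnA addnCA leq_addr.
have /h4 {}h4 : (K4 <= n)%N by apply: leq_trans hn; rewrite leq_addl.
move: h1 h2 h3 h4.
have [-> _ _] := subtri_vertexl a b c; have [-> _ _] := subtri_vertexm a b c.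
have [-> _ _] := subtri_vertexr a b c; have [-> _ _] := subtri_middle a b c.
set T1 := tri _ _ _ _ _; set T2 := tri _ _ _ _ _; set T3 := tri _ _ _ _ _.
set T4 := tri _ _ _ _ _ => h1 h2 h3 h4.
have e4 : e * (per a b c / 2) ^+ 2 = e * per a b c ^+ 2 / 4 by field.
rewrite e4 in h1 h2 h3 h4.
have := ncD (T1 + T2 + T3) T4; have := ncD (T1 + T2) T3; have := ncD T1 T2.
by lra.
Qed.

(* [tri f n a b c] is additive under subdivision once n is shifted by one, so
   Goursat's bisection argument applies to it for all large n at once. *)
Lemma goursat (r : R) f a b c :
  (forall z, r <= re z -> cdiff f z) ->
  r <= re a -> r <= re b -> r <= re c ->
  forall e : R, 0 < e -> exists K, forall n, (K <= n)%N -> nc (tri f n a b c) <= e.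
Proof.
move=> hf ra rb rc e e0.
suff [e' e'0 he'] : exists2 e' : R, 0 < e' & e' * per a b c ^+ 2 <= e.
  have H : tri_small f e' a b c; last first.
    by have [K hK] := H; exists K => n /hK /le_trans; apply.
  apply: contrapT => Nabc.
  pose bad (t : C * C * C) := ~ tri_small f e' t.1.1 t.1.2 t.2.
  pose sub (t t' : C * C * C) := subtri t.1.1 t.1.2 t.2 t'.1.1 t'.1.2 t'.2.
  (* Every bad triangle has a bad subtriangle; on the other triangles the value of [next] is
     arbitrary. *)
  have /choice[next hnext] : forall t, exists t', bad t -> bad t' /\ sub t t'.
    move=> t; have [bt|] := pselect (bad t); last by exists t.
    apply: contrapT => /forallNP h; apply: bt; apply: tri_small_split => a' b' c' s.
    by apply: contrapT => bt'; apply: (h (a', b', c')) => _; split.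
  pose T n := iter n next (a, b, c).
  have badT n : bad (T n) by elim: n => //= n /hnext[].
  have subT n : sub (T n) (T n.+1) by have [] := hnext _ (badT n).
  pose p := per a b c.
  have perT n : per (T n).1.1 (T n).1.2 (T n).2 = p / 2 ^+ n.
    elim: n => [|n IH]; first by rewrite expr0 divr1.
    by have [-> _ _] := subT n; rewrite IH exprSr invfM mulrA.
  have [l hl] : exists l, forall n, nc ((T n).1.1 - l) <= 4 * p / 2 ^+ n.
    by apply: complex_geometric_limit => n; have [_ + _] := subT n; rewrite perT.
  have reT n : [/\ r <= re (T n).1.1, r <= re (T n).1.2 & r <= re (T n).2].
    elim: n => [|n [h1 h2 h3]] //; have [_ _ h] := subT n.
    apply: (h (fun z => r <= re z)) => // x y hx hy; rewrite re_mid; lra.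
  have p0 : 0 <= p by exact: per_ge0.
  have small (d : R) : 0 < d -> exists n, 5 * p / 2 ^+ n < d.
    move=> d0; have [n hn] : exists n : nat, 5 * p / d < n%:R.
      exists (Num.bound (5 * p / d)); apply: archi_boundP.
      by rewrite mulr_ge0 ?mulr_ge0 // invr_ge0 ltW.
    exists n; rewrite ltr_pdivrMr ?exprn_gt0 // -ltr_pdivrMl // mulrC.
    apply: lt_le_trans hn _; rewrite -natrX ler_nat ltnW //; exact: ltn_expl.
  (* The half plane is closed, so differentiability is still available at the limit point of the
     nested triangles. *)
  have rl : r <= re l.
    apply/ler_addgt0Pr => d d0; have [n hn] := small d d0.
    have [hr _ _] := reT n; have := re_le_nc ((T n).1.1 - l).
    have pn : 0 <= p / 2 ^+ n by rewrite mulr_ge0 // invr_ge0 exprn_ge0.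
    have := hl n; rewrite reD reN; move: hn; rewrite -!mulrA => h1 h2 h3.
    have : re (T n).1.1 - re l <= `|re (T n).1.1 - re l| by exact: ler_norm.
    by lra.
  have [al hal] := hf l rl.
  (* The n-th triangle lies within 5p/2^n of [l]: 4p/2^n for its first vertex and p/2^n for its
     perimeter. The remainder of the linear approximation is thus at most (e'/5)(5p/2^n), and
     multiplying by the perimeter gives e' (p/2^n)^2. *)
  have [d d0 hd] := hal (e' / 5) (divr_gt0 e'0 (ltr0Sn _ _)).
  have [n hn] := small d d0.
  apply: (badT n); exists 0 => m _; rewrite perT.
  have pn : 0 <= p / 2 ^+ n by rewrite mulr_ge0 // invr_ge0 exprn_ge0.
  have dist x y : nc (y - x) <= p / 2 ^+ n -> nc (x - l) <= 4 * p / 2 ^+ n ->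
    nc (y - l) <= 5 * p / 2 ^+ n.
    have -> : y - l = (y - x) + (x - l) by ring.
    by have := ncD (y - x) (x - l); rewrite -!mulrA; lra.
  rewrite -(tri_sub_affine f l al).
  apply: le_trans (tri_bound (P := fun z => nc (z - l) <= 5 * p / 2 ^+ n)
    (M := e' / 5 * (5 * p / 2 ^+ n)) _ _ _ _ _ _) _.
  - exact: midclosed_ball.
  - move=> z hz; have := hd _ (le_lt_trans hz hn).
    by move/le_trans; apply; apply: ler_wpM2l => //; rewrite divr_ge0 // ltW.
  - by apply: le_trans (hl n) _; rewrite -!mulrA; lra.
  - by apply: dist (hl n); rewrite -perT; exact: le_perl.
  - by apply: dist (hl n); rewrite -perT; exact: le_perr.
  - rewrite perT le_eqVlt; apply/orP; left; apply/eqP; field.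
    by rewrite expf_neq0.
have [p0|p0] := eqVneq (per a b c) 0.
  by exists 1 => //; rewrite p0 expr0n mulr0 ltW.
have p2 : 0 < per a b c ^+ 2 by rewrite exprn_gt0 // lt0r p0 per_ge0.
by exists (e / per a b c ^+ 2); rewrite ?divr_gt0 // divfK ?gt_eqF.
Qed.

End Goursat.

(** * The Cauchy estimate on a square *)

Section CauchyEstimate.
Variable R : realType.
Local Notation C := (Cplx R).
Implicit Types (f g h : C -> C) (z w a b c : C).

Lemma ltr0C (e : R) : (0 < real_complex R e :> C) = (0 < e).
Proof. by rewrite ltcE /= eqxx. Qed.

Lemma differentiable_cdiff f z : differentiable f z -> cdiff f z.
Proof.
move/derivable1_diffP => /cvg_ex[l hl]; exists l => e e0.
have quot (F k d : C) : d != 0 -> nc (k - d^-1 * F) <= e ->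
    nc (F - k * d) <= e * nc d.
  move=> d0 h; rewrite (_ : F - k * d = - ((k - d^-1 * F) * d)); last by field.
  by rewrite ncN ncM; apply: ler_wpM2r => //; exact: nc_ge0.
have /cvgrPdist_lt/(_ (real_complex R e)) := hl.
rewrite ltr0C => /(_ e0); rewrite near_withinE => /nbhs_ballP[d /= d0 hd].
have dE : d = real_complex R (re d).
  by rewrite RRe_real //; exact: gtr0_real.
exists (re d); first by rewrite -ltr0C -dE.
move=> w hw; have [->|wz] := eqVneq w z.
  by rewrite !subrr mulr0 subr0 nc0 mulr0.
have wz0 : w - z != 0 by rewrite subr_eq0.
have := hd (w - z); rewrite /ball /= sub0r normrN normE dE ltcR => /(_ hw wz0).
rewrite /GRing.scale /= mulr1 subrK normE ltcR => /ltW hq.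
exact: (quot (f w - f z) l (w - z) wz0 hq).
Qed.

Definition vanishing (u : nat -> C) := forall e : R, 0 < e ->
  exists K, forall n, (K <= n)%N -> nc (u n) <= e.

Lemma eq_vanishing u v : u =1 v -> vanishing u -> vanishing v.
Proof. by move/funext ->. Qed.

Lemma vanishingD u v : vanishing u -> vanishing v -> vanishing (u \+ v).
Proof.
move=> hu hv e e0; have e2 : 0 < e / 2 by rewrite divr_gt0.
have [K hK] := hu _ e2; have [L hL] := hv _ e2.
exists (K + L)%N => n hn; apply: le_trans (ncD _ _) _.
have := hK n (leq_trans (leq_addr _ _) hn).
by have := hL n (leq_trans (leq_addl _ _) hn); lra.
Qed.

Lemma re_half z : re (z / 2) = re z / 2.
Proof. by rewrite half_def reM /= mulr0 subr0. Qed.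

(** Each halving towards the corner 0 cuts off three triangles lying in a half plane Re z >= r with
    r > 0, where [goursat] applies; only the corner triangle remains, one depth lower. *)
Lemma vanishing_shift_tri h a b k :
  (forall z, 0 < re z -> cdiff h z) -> 0 < re a -> 0 < re b ->
  vanishing (fun n => tri h (n + k)%N 0 a b - tri h n 0 (a / 2 ^+ k) (b / 2 ^+ k)).
Proof.
move=> dh a0 b0; elim: k => [|k IH].
  by move=> e e0; exists 0 => n _; rewrite addn0 expr0 !divr1 subrr nc0 ltW.
have pos (c : C) : 0 < re c -> 0 < re (c / 2 ^+ k).
  elim: k {IH} => [|k IH] c0; first by rewrite expr0 divr1.
  by rewrite exprSr invfM mulrA re_half divr_gt0 ?IH.
pose a' := a / 2 ^+ k; pose b' := b / 2 ^+ k.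
have a'0 : 0 < re a' by exact: pos.
have b'0 : 0 < re b' by exact: pos.
have half0 (c : C) : 0 < re c -> 0 < re (c / 2) by move=> c0; rewrite re_half divr_gt0.
have mida : mid 0 a' = a' / 2 by rewrite /mid add0r.
have midb : mid b' 0 = b' / 2 by rewrite /mid addr0.
pose r := Num.min (re a') (re b') / 2.
have r0 : 0 < r by rewrite divr_gt0 // lt_min a'0.
have ra : r <= re a' / 2 by rewrite /r ler_pM2r ?invr_gt0 // ge_min lexx.
have rb : r <= re b' / 2 by rewrite /r ler_pM2r ?invr_gt0 // ge_min lexx orbT.
have dh' z : r <= re z -> cdiff h z by move=> rz; apply: dh; exact: lt_le_trans rz.
have ra2 : r <= re (a' / 2) by rewrite re_half.
have rb2 : r <= re (b' / 2) by rewrite re_half.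
have rm : r <= re (mid a' b') by rewrite re_mid; lra.
have ra' : r <= re a' by lra.
have rb' : r <= re b' by lra.
have V1 : vanishing (fun n => tri h n (a' / 2) a' (mid a' b')) by apply: (@goursat _ r).
have V2 : vanishing (fun n => tri h n (b' / 2) (mid a' b') b') by apply: (@goursat _ r).
have V3 : vanishing (fun n => tri h n (a' / 2) (mid a' b') (b' / 2)) by apply: (@goursat _ r).
have IH' : vanishing (fun n => tri h (n + k.+1)%N 0 a b - tri h n.+1 0 a' b').
  move=> e e0; have [K hK] := IH e e0; exists K => n hn.
  by rewrite addnS -addSn; apply: hK; exact: leqW.
apply: eq_vanishing (vanishingD (vanishingD (vanishingD IH' V1) V2) V3) => n /=.
rewrite tri_split mida midb.
have -> : a / 2 ^+ k.+1 = a' / 2 by rewrite exprSr invfM mulrA.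
have -> : b / 2 ^+ k.+1 = b' / 2 by rewrite exprSr invfM mulrA.
ring.
Qed.

(* The integrand is only assumed bounded at the vertex 0: shrinking the
   triangle towards that vertex makes its contribution negligible. *)
Lemma goursat_corner h a b :
  (forall z, 0 < re z -> cdiff h z) ->
  (exists B d : R, 0 < d /\ forall z, nc z <= d -> nc (h z) <= B) ->
  0 < re a -> 0 < re b -> vanishing (fun n => tri h n 0 a b).
Proof.
move=> dh [B [d [d0 hB]]] a0 b0 e e0.
have B0 : 0 <= B by apply: le_trans (nc_ge0 (h 0)) (hB _ _); rewrite nc0 ltW.
pose p := per 0 a b + 1.
have p0 : 0 < p by rewrite /p ltr_wpDl // per_ge0.
have [k hk] : exists k, p / 2 ^+ k <= d /\ B * (p / 2 ^+ k) <= e / 2.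
  pose X := p / d + 2 * B * p / e.
  have X0 : 0 <= X.
    by rewrite /X addr_ge0 // divr_ge0 ?mulr_ge0 // ?ltW.
  have [k hk] : exists k : nat, X < k%:R by exists (Num.bound X); exact: archi_boundP.
  have {}hk : X <= 2 ^+ k.
    by apply/ltW/(lt_le_trans hk); rewrite -natrX ler_nat ltnW //; exact: ltn_expl.
  have X1 : 0 <= p / d by rewrite divr_ge0 // ltW.
  have X2 : 0 <= 2 * B * p / e by rewrite divr_ge0 ?mulr_ge0 // ?ltW.
  have k0 : 0 < 2 ^+ k :> R by rewrite exprn_gt0.
  exists k; split.
    rewrite ler_pdivrMr // -ler_pdivrMl // mulrC.
    by apply: le_trans hk; rewrite /X lerDl.
  rewrite mulrA ler_pdivrMr // -ler_pdivrMl ?divr_gt0 //.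
  by apply: le_trans hk; apply: le_trans (_ : 2 * B * p / e <= X);
    [rewrite le_eqVlt; apply/orP; left; apply/eqP; field; rewrite gt_eqF
    |rewrite /X lerDr].
have [hk1 hk2] := hk.
have pkE : per 0 (a / 2 ^+ k) (b / 2 ^+ k) = per 0 a b / 2 ^+ k.
  elim: k {hk hk1 hk2} => [|k IH]; first by rewrite expr0 !divr1.
  rewrite !exprSr !invfM !mulrA -IH /per !subr0 !sub0r !ncN.
  by rewrite -mulrBl !nc_half; field.
have pk : per 0 (a / 2 ^+ k) (b / 2 ^+ k) <= p / 2 ^+ k.
  by rewrite pkE ler_pM2r ?invr_gt0 ?exprn_gt0 // /p lerDl.
have e2 : 0 < e / 2 by rewrite divr_gt0.
have [K hK] := vanishing_shift_tri k dh a0 b0 e2.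
exists (K + k)%N => n hn.
have kn : (k <= n)%N by apply: leq_trans hn; rewrite leq_addl.
have := hK (n - k)%N; rewrite subnK // leq_subRL // addnC => /(_ hn).
set T := tri h (n - k) _ _ _.
have hT : nc T <= e / 2.
  apply: le_trans hk2; apply: le_trans (_ : B * per 0 (a / 2 ^+ k) (b / 2 ^+ k) <= _).
    apply: (tri_bound _ (P := fun z => nc (z - 0) <= d)).
    - exact: midclosed_ball.
    - by move=> z; rewrite subr0; exact: hB.
    - by rewrite subrr nc0 ltW.
    - exact: le_trans (le_perl _ _ _) (le_trans pk hk1).
    - exact: le_trans (le_perr _ _ _) (le_trans pk hk1).
  by rewrite ler_wpM2l.
have -> : tri h n 0 a b = (tri h n 0 a b - T) + T by rewrite subrK.
by have := ncD (tri h n 0 a b - T) T; rewrite subrK; lra.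
Qed.

(** On the segment 1 + is with |s| <= 1 the real part of 1/z is 1/(1 + s^2) >= 1/2, and dz = i ds.
    Over the whole edge from 1 - i to 1 + i this gives 1, a lower bound for the exact value pi/2. *)
Lemma im_trap_inv n a b : re a = 1 -> re b = 1 ->
  `|im a| <= 1 -> `|im b| <= 1 -> im a <= im b ->
  (im b - im a) / 2 <= im (trap (fun z => z^-1) n a b).
Proof.
elim: n a b => [|n IH] a b a1 b1 ha hb ab /=; last first.
  have m1 : re (mid a b) = 1 by rewrite re_mid a1 b1; field.
  have mE := im_mid a b.
  have hm : `|im (mid a b)| <= 1.
    by move: ha hb; rewrite !ler_norml mE => /andP[? ?] /andP[? ?]; apply/andP; split; lra.
  have := IH a (mid a b) a1 m1 ha hm; have := IH (mid a b) b m1 b1 hm hb.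
  by rewrite imD mE; lra.
have V (c : C) : re c = 1 -> `|im c| <= 1 -> 1 / 2 <= re c^-1.
  case: c => x y; rewrite /re /im /= => -> hy.
  have y2 : y ^+ 2 <= 1 by rewrite -real_normK ?num_real // exprn_ile1.
  rewrite expr1n ler_pM2l // lef_pV2 ?posrE //; last by rewrite ltr_pwDl // sqr_ge0.
  by rewrite -[leRHS]/(1 + 1) lerD2l.
have := V _ a1 ha; have := V _ b1 hb => h1 h2.
rewrite imM imD reD reN a1 b1 subrr mulr0 addr0 half_def reM /= mulr0 subr0 imN reD.
set d := im b - im a; have d0 : 0 <= d by rewrite subr_ge0.
rewrite -[leLHS]mulrC; apply: ler_wpM2r => //; lra.
Qed.

Lemma trapZ f k n a b : trap (fun z => k * f z) n a b = k * trap f n a b.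
Proof. by elim: n a b => [|n IH] a b /=; rewrite ?IH; ring. Qed.

Lemma nc_ge1 z : re z = 1 -> 1 <= nc z.
Proof. by move=> z1; apply: le_trans (re_le_nc _); rewrite z1 normr1. Qed.

(* Comparing the integrals of f(z)/z and f(0)/z over the square with vertices
   ±1±i; the constant 2 is not optimal. *)
Lemma square_bound f (M : R) : (forall z, differentiable f z) ->
  (forall j (s : R), (j < 4)%N -> `|s| <= 1 ->
    nc (f ((0 +i* 1)%C ^+ j * (1 +i* s)%C)) <= M) ->
  nc (f 0) <= 2 * M.
Proof.
move=> df fM; set J : C := (0 +i* 1)%C.
have J2 : J * J = -1 by apply/eqP; rewrite eq_complex /=; apply/andP; split; apply/eqP; ring.
have J4 : J ^+ 4 = 1 by rewrite -[4%N]/(2 * 2)%N exprM (expr2 J) J2 sqrrN expr1n.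
have J0 j : J ^+ j != 0.
  rewrite expf_neq0 //; apply/eqP => J0; move: J2; rewrite J0 mul0r => /eqP.
  by rewrite eq_sym oppr_eq0 oner_eq0.
(* The segment from p to q is the right edge of the square. As q = ip, multiplication by powers of i
   carries it to the four edges in turn, and [F j] is [f] seen from the j-th of them. *)
pose p : C := (1 -i* 1)%C; pose q : C := (1 +i* 1)%C.
have qE : q = J * p.
  by apply/eqP; rewrite eq_complex /=; apply/andP; split; apply/eqP; ring.
pose F j z := f (J ^+ j * z); pose g z := (f z - f 0) / z.
pose G j z := (F j z - f 0) / z.
have dF j z : differentiable (F j) z.
  apply: differentiable_comp; last exact: df.
  by apply: differentiableM => //; exact: differentiable_cst.
have dG j z : z != 0 -> cdiff (G j) z.
  move=> z0; apply: differentiable_cdiff; apply: differentiableM.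
    by apply: differentiableB => //; exact: differentiable_cst.
  by apply: differentiableV.
(* Near 0 the difference quotient is within 1 of the derivative of [F j]; at 0 itself its value is
   0, by the convention for the inverse of 0. *)
have bG j : exists B d : R, 0 < d /\ forall z, nc z <= d -> nc (G j z) <= B.
  have [al hal] := differentiable_cdiff (dF j 0).
  have [d d0 hd] := hal 1 ltr01.
  exists (nc al + 1), (d / 2); split=> [|z hz]; first by rewrite divr_gt0.
  have [->|z0] := eqVneq z 0.
    by rewrite /G invr0 mulr0 nc0 addr_ge0 ?nc_ge0.
  have := hd z; rewrite subr0 => /(_ ltac:(lra)).
  have -> : F j 0 = f 0 by rewrite /F mulr0.
  rewrite -ler_pdivrMr ?nc_gt0 // -ncV -ncM.
  have -> : (F j z - f 0 - al * z) * z^-1 = G j z - al by rewrite /G; field.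
  move=> h; have := ncD (G j z - al) al; rewrite subrK; lra.
have VG j : vanishing (fun n => tri (G j) n 0 p q).
  apply: (goursat_corner _ (bG j) (ltr01 : 0 < re p) (ltr01 : 0 < re q)) => z z0.
  by apply: dG; apply/eqP => zE; move: z0; rewrite zE ltxx.
have GE j n a b : trap (G j) n a b = trap g n (J ^+ j * a) (J ^+ j * b).
  rewrite -trap_scale mulrC -trapZ; apply: eq_trap => z; rewrite /G /g /F.
  by rewrite invfM [RHS]mulrCA mulVKf.
pose S n := tri (G 0) n 0 p q + tri (G 1) n 0 p q + tri (G 2) n 0 p q +
  tri (G 3) n 0 p q.
have VS : vanishing S.
  by apply: vanishingD => //; apply: vanishingD => //; apply: vanishingD.
(* The sides through 0 cancel in pairs: the side at q of one quarter is the side at p of the next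
   one, and the last quarter meets the first because i^4 = 1. *)
have SE n : S n = trap (G 0) n p q + trap (G 1) n p q + trap (G 2) n p q +
    trap (G 3) n p q.
  rewrite /S /tri !(trapN (G _) n 0) !(GE _ _ 0) !mulr0 qE !mulrA -!exprSr J4 expr0.
  by ring.
have TE j n : trap (G j) n p q =
    trap (fun z => F j z / z) n p q - f 0 * trap (fun z => z^-1) n p q.
  by rewrite -trap_sub; apply: eq_trap => z; rewrite /G mulrBl.
pose P z := re z = 1 /\ `|im z| <= 1.
have mP : midclosed P.
  move=> a b [a1 ha] [b1 hb]; split; first by rewrite re_mid a1 b1; field.
  rewrite im_mid; move: ha hb; rewrite !ler_norml => /andP[? ?] /andP[? ?].
  by apply/andP; split; lra.
have Pp : P p by rewrite /P /p /re /im /= normrN normr1.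
have Pq : P q by rewrite /P /q /re /im /= normr1.
have pq : nc (q - p) = 2.
  rewrite /nc /q /p /= subrr opprK expr0n /= add0r sqrtr_sqr ger0_norm ?addr_ge0 //.
have M0 : 0 <= M by apply: le_trans (nc_ge0 _) (fM 0 0 _ _); rewrite ?normr0.
have FM j n : (j < 4)%N -> nc (trap (fun z => F j z / z) n p q) <= M * 2.
  move=> j4; rewrite -pq; apply: (trap_bound _ mP) => // z [z1 hz]; rewrite ncM ncV.
  have -> : z = (1 +i* im z)%C by rewrite -z1; case: (z).
  have n1 := nc_ge1 z1; have n0 : 0 < nc z by exact: lt_le_trans n1.
  rewrite ler_pdivrMr; last by case: z z1 n0 {hz n1} => x y; rewrite /re /im /= => ->.
  apply: le_trans (fM _ _ j4 hz) _.
  by rewrite ler_peMr // nc_ge1.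
apply/ler_addgt0Pr => e e0; have [K hK] := VS e e0.
have {hK} := hK K (leqnn _).
set T := trap (fun z => z^-1) K p q.
have T1 : 1 <= nc T.
  apply: le_trans (im_le_nc _); apply: le_trans (ler_norm _).
  case: Pp => p1 hp; case: Pq => q1 hq.
  apply: le_trans (im_trap_inv K p1 q1 hp hq _).
    by rewrite /q /p /im /=; lra.
  by rewrite /q /p /im /=; lra.
have := FM 0 K isT; have := FM 1 K isT; have := FM 2 K isT; have := FM 3 K isT.
rewrite SE !TE -/T.
set t0 := trap _ K p q; set t1 := trap _ K p q; set t2 := trap _ K p q.
set t3 := trap _ K p q => h3 h2 h1 h0.
set s := (X in nc X <= e -> _) => hs.
(* 4 f(0) T is the sum of the four edge sums, each of modulus at most 2M, minus [s] of modulus at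
   most e. Since |T| >= 1, this yields |f(0)| <= 2M + e/4. *)
have [k kE nk] : exists2 k : C, k = 2 * 2 & nc k = 4.
  by exists (2 * 2); rewrite // ncM nc2; ring.
have sE : k * (f 0 * T) = t0 + t1 + t2 + t3 + - s by rewrite kE /s; ring.
have := ncD (t0 + t1 + t2 + t3) (- s); rewrite -sE ncN ncM (ncM (f 0)).
have := ncD (t0 + t1 + t2) t3; have := ncD (t0 + t1) t2; have := ncD t0 t1.
rewrite nk.
have : nc (f 0) <= nc (f 0) * nc T by rewrite ler_peMr // nc_ge0.
lra.
Qed.

End CauchyEstimate.

(** * Regular functions on Zariski spaces *)

Section PolynomialFunctions.
Variable K : closedFieldType.

Definition polyfun n (f : 'rV[K]_n -> K) : Prop := exists p, f = peval p.

Section Closure.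
Variable n : nat.
Implicit Types (f g : 'rV[K]_n -> K).

Lemma polyfun_peval p : polyfun (@peval K n p).
Proof. by exists p. Qed.

Lemma polyfun_cst (c : K) : polyfun (fun _ : 'rV[K]_n => c).
Proof. by exists (mpoly.mpolyC n c); apply/funext => x; rewrite /peval mpoly.mevalC. Qed.

Lemma polyfun_coord i : polyfun (fun x : 'rV[K]_n => x 0 i).
Proof.
by exists (mpoly.mpolyX K (mpoly.mnm1 i)); apply/funext => x; rewrite /peval mpoly.mevalXU.
Qed.

Lemma polyfunD f g : polyfun f -> polyfun g -> polyfun (fun x => f x + g x).
Proof.
by move=> [p ->] [q ->]; exists (p + q); apply/funext => x; rewrite /peval mpoly.mevalD.
Qed.

Lemma polyfunM f g : polyfun f -> polyfun g -> polyfun (fun x => f x * g x).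
Proof.
by move=> [p ->] [q ->]; exists (p * q); apply/funext => x; rewrite /peval mpoly.mevalM.
Qed.

Lemma polyfunN f : polyfun f -> polyfun (fun x => - f x).
Proof. by move=> [p ->]; exists (- p); apply/funext => x; rewrite /peval mpoly.mevalN. Qed.

Lemma polyfunB f g : polyfun f -> polyfun g -> polyfun (fun x => f x - g x).
Proof. by move=> hf hg; apply: polyfunD => //; apply: polyfunN. Qed.

Lemma polyfunX f k : polyfun f -> polyfun (fun x => f x ^+ k).
Proof.
move=> hf; elim: k => [|k IH]; first by under eq_fun do rewrite expr0; exact: polyfun_cst.
by under eq_fun do rewrite exprS; exact: polyfunM.
Qed.

(** Polynomial functions are generated by constants and coordinates under sum and product;
    substitution, continuity and differentiability are all proved along this principle. *)
Lemma polyfun_ind (P : ('rV[K]_n -> K) -> Prop) :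
  (forall c, P (fun=> c)) -> (forall i, P (fun x => x 0 i)) ->
  (forall f g, P f -> P g -> P (fun x => f x + g x)) ->
  (forall f g, P f -> P g -> P (fun x => f x * g x)) ->
  forall f, polyfun f -> P f.
Proof.
move=> Pc Pi PD PM _ [p ->].
have PX f k : P f -> P (fun x => f x ^+ k).
  move=> hf; elim: k => [|k IH]; first by under eq_fun do rewrite expr0; exact: Pc.
  by under eq_fun do rewrite exprS; exact: PM.
have Pprod (r : seq 'I_n) (m : 'I_n -> nat) :
    P (fun x => \prod_(i <- r) x 0 i ^+ m i).
  elim: r => [|i r IH]; first by under eq_fun do rewrite big_nil; exact: Pc.
  by under eq_fun do rewrite big_cons; apply: PM => //; exact: PX.
elim/mpoly.mpolyind: p => [|c m p _ _ IH].
  have -> : @peval K n 0 = (fun=> 0) by apply/funext => x; rewrite /peval mpoly.meval0.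
  exact: Pc.
have -> : @peval K n (c *: mpoly.mpolyX K m + p) =
    (fun x => c * \prod_i x 0 i ^+ m i + peval p x).
  by apply/funext => x; rewrite /peval mpoly.mevalD mpoly.mevalZ mpoly.mevalX.
by apply: PD => //; apply: PM.
Qed.

End Closure.

Lemma polyfun_comp m n (s : 'rV[K]_m -> 'rV[K]_n) f :
  (forall i, polyfun (fun x => s x 0 i)) -> polyfun f -> polyfun (f \o s).
Proof.
move=> hs hf; elim/polyfun_ind: hf => [c|i|g h|g h].
- exact: polyfun_cst.
- exact: hs.
- exact: polyfunD.
- exact: polyfunM.
Qed.

End PolynomialFunctions.

(** * Zariski-open sets and locally rational functions *)

Section ZariskiTopology.
Variables (K : closedFieldType) (n : nat).
Implicit Types (D U Z : set 'rV[K]_n) (f g : 'rV[K]_n -> K).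

Lemma zopenP D : zopen D <->
  exists I : set (mpoly.mpoly n K), D = [set x | exists2 p, I p & peval p x != 0].
Proof.
split=> [[I OI]|[I ->]]; exists I; last first.
  rewrite predeqE => x; split=> [h p Ip|h [p Ip]].
    by apply: contrapT => /eqP px; apply: h; exists p.
  by rewrite (h p Ip) eqxx.
rewrite -(setCK D) OI predeqE => x; split=> [/existsNP[p /not_implyP[Ip /eqP px]]|].
  by exists p.
by move=> [p Ip /eqP px] /(_ p Ip).
Qed.

Lemma zclosedC Z : zclosed Z <-> zopen (~` Z).
Proof. by rewrite /zopen setCK. Qed.

Lemma zopenT : zopen [set: 'rV[K]_n].
Proof.
apply/zopenP; exists [set 1]; rewrite predeqE => x; split=> // _; exists 1 => //.
by rewrite /peval mpoly.meval1 oner_neq0.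
Qed.

Lemma zopenI D D' : zopen D -> zopen D' -> zopen (D `&` D').
Proof.
move=> /zopenP[I ->] /zopenP[J ->]; apply/zopenP.
exists [set p * q | p in I & q in J]; rewrite predeqE => x; split.
  move=> [[p Ip px] [q Jq qx]]; exists (p * q); first by exists p => //; exists q.
  by rewrite /peval mpoly.mevalM mulf_neq0.
move=> [_ [p Ip [q Jq <-]]]; rewrite /peval mpoly.mevalM mulf_eq0 negb_or.
by move=> /andP[px qx]; split; [exists p|exists q].
Qed.

Lemma zopen_bigcup (F : set (set 'rV[K]_n)) :
  F `<=` @zopen K n -> zopen (\bigcup_(D in F) D).
Proof.
move=> hF; apply/zopenP.
(* Taking every polynomial whose non-vanishing locus lies in the union avoids choosing equations for
   each member of the family. *)
exists [set p | forall x, peval p x != 0 -> (\bigcup_(D in F) D) x].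
rewrite predeqE => x; split=> [[D FO Ox]|[p hp px]]; last exact: hp.
have /zopenP[I OI] := hF _ FO; move: Ox; rewrite OI => -[p Ip px]; exists p => //.
by move=> y py; exists D => //; rewrite OI; exists p.
Qed.

Lemma zopen_neq0 f : polyfun f -> zopen [set x | f x != 0].
Proof.
move=> [p ->]; apply/zopenP; exists [set p]; rewrite predeqE => x.
by split=> [px|[_ ->]//]; exists p.
Qed.

Lemma zclosed_eq0 f : polyfun f -> zclosed [set x | f x = 0].
Proof.
move=> /zopen_neq0 h; rewrite zclosedC (_ : ~` _ = [set x | f x != 0]) //.
by rewrite predeqE => x; split=> /eqP.
Qed.

Lemma zclosedI Z Z' : zclosed Z -> zclosed Z' -> zclosed (Z `&` Z').
Proof.
move=> [I ->] [J ->]; exists (I `|` J); rewrite predeqE => x; split.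
  by move=> [hI hJ] p [/hI|/hJ].
by move=> h; split=> p hp; apply: h; [left|right].
Qed.

Definition relopen Z U := exists2 D, zopen D & U = Z `&` D.

Lemma relopenP Z U : U `<=` Z ->
  (forall x, U x -> exists D, [/\ zopen D, D x & Z `&` D `<=` U]) -> relopen Z U.
Proof.
move=> UZ h; exists (\bigcup_(D in [set D | zopen D /\ Z `&` D `<=` U]) D).
  by apply: zopen_bigcup => D [].
rewrite predeqE => x; split=> [Ux|[Zx [D [_ h'] Ox]]]; last exact: h'.
by split; [exact: UZ|have [D [zO Ox ZO]] := h x Ux; exists D].
Qed.

(** This is [reg (zariski Z) U f] unfolded; the ambient set [Z] does not enter it. *)
Definition regular U f : Prop := forall x, U x -> exists D p q,
  [/\ zopen D, D x &
      forall y, U y -> D y -> peval q y != 0 /\ f y = peval p y / peval q y].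

Lemma regularI U f : (forall x, U x -> exists D p q,
  [/\ zopen D, D x, polyfun p, polyfun q &
      forall y, U y -> D y -> q y != 0 /\ f y = p y / q y]) -> regular U f.
Proof.
by move=> h x /h[D [_ [_ [zO Ox [p ->] [q ->] hpq]]]]; exists D, p, q.
Qed.

Lemma regular_sub U U' f : U `<=` U' -> regular U' f -> regular U f.
Proof.
move=> UU' h x /UU'/h[D [p [q [zO Ox hpq]]]]; exists D, p, q; split=> // y /UU'.
exact: hpq.
Qed.

Lemma eq_regular U f g : (forall x, U x -> f x = g x) -> regular U f -> regular U g.
Proof.
move=> fg h x /h[D [p [q [zO Ox hpq]]]]; exists D, p, q; split=> // y Uy.
by rewrite -fg //; exact: hpq.
Qed.

Lemma regular_local U f :
  (forall x, U x -> exists D, [/\ zopen D, D x & regular (U `&` D) f]) -> regular U f.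
Proof.
move=> h x Ux; have [D [zO Ox hO]] := h x Ux.
have [D' [p [q [zO' D'x hpq]]]] := hO x (conj Ux Ox).
exists (D `&` D'), p, q; split=> //; first exact: zopenI.
by move=> y Uy [Oy]; exact: hpq.
Qed.

Lemma regular_polyfun U f : polyfun f -> regular U f.
Proof.
move=> hf; apply: regularI => x _; exists setT, f, (fun=> 1).
split=> //; [exact: zopenT|exact: polyfun_cst|move=> y _ _].
by rewrite oner_neq0 divr1.
Qed.

Lemma regularD U f g : regular U f -> regular U g -> regular U (fun x => f x + g x).
Proof.
move=> hf hg; apply: regularI => x Ux.
have [D [p [q [zO Ox hpq]]]] := hf x Ux; have [D' [p' [q' [zO' D'x hpq']]]] := hg x Ux.
exists (D `&` D'), (fun x => peval p x * peval q' x + peval p' x * peval q x).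
exists (fun x => peval q x * peval q' x).
split=> //; first exact: zopenI.
- by apply: polyfunD; apply: polyfunM; apply: polyfun_peval.
- by apply: polyfunM; apply: polyfun_peval.
move=> y Uy [Oy D'y]; have [q0 ->] := hpq y Uy Oy; have [q'0 ->] := hpq' y Uy D'y.
by rewrite mulf_neq0 // addf_div.
Qed.

Lemma regularM U f g : regular U f -> regular U g -> regular U (fun x => f x * g x).
Proof.
move=> hf hg; apply: regularI => x Ux.
have [D [p [q [zO Ox hpq]]]] := hf x Ux; have [D' [p' [q' [zO' D'x hpq']]]] := hg x Ux.
exists (D `&` D'), (fun x => peval p x * peval p' x), (fun x => peval q x * peval q' x).
split=> //; first exact: zopenI.
- by apply: polyfunM; apply: polyfun_peval.
- by apply: polyfunM; apply: polyfun_peval.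
move=> y Uy [Oy D'y]; have [q0 ->] := hpq y Uy Oy; have [q'0 ->] := hpq' y Uy D'y.
by rewrite mulf_neq0 // mulf_div.
Qed.

Lemma regular_cst U (c : K) : regular U (fun=> c).
Proof. by apply: regular_polyfun; exact: polyfun_cst. Qed.

Lemma regularB U f g : regular U f -> regular U g -> regular U (fun x => f x - g x).
Proof.
move=> hf hg; apply: regularD => //.
under eq_fun do rewrite -mulN1r; apply: regularM => //; exact: regular_cst.
Qed.

Lemma regular_neq0 U f x : regular U f -> U x -> f x != 0 ->
  exists D, [/\ zopen D, D x & forall y, U y -> D y -> f y != 0].
Proof.
move=> hf Ux fx; have [D [p [q [zO Ox hpq]]]] := hf x Ux.
exists (D `&` [set y | peval p y != 0]); split.
- by apply: zopenI => //; apply: zopen_neq0; exact: polyfun_peval.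
- split=> //=; apply: contraNneq fx => px.
  by have [_ ->] := hpq x Ux Ox; rewrite px mul0r.
move=> y Uy [Oy /= py]; have [qy ->] := hpq y Uy Oy.
by rewrite mulf_neq0 ?invr_eq0.
Qed.

Lemma regularV U f : regular U f -> (forall x, U x -> f x != 0) ->
  regular U (fun x => (f x)^-1).
Proof.
move=> hf f0; apply: regularI => x Ux; have [D [p [q [zO Ox hpq]]]] := hf x Ux.
exists D, (peval q), (peval p); split=> //; try exact: polyfun_peval.
move=> y Uy Oy; have := f0 y Uy; have [q0 ->] := hpq y Uy Oy.
by rewrite mulf_eq0 negb_or invf_div => /andP[].
Qed.

End ZariskiTopology.

Section RegularComposition.
Variables (K : closedFieldType) (m n : nat) (s : 'rV[K]_m -> 'rV[K]_n).
Variable U : set 'rV[K]_m.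
Hypothesis reg_s : forall i, regular U (fun x => s x 0 i).

Lemma regular_comp_polyfun f : polyfun f -> regular U (f \o s).
Proof.
move=> hf; elim/polyfun_ind: hf => [c|i|g h|g h].
- exact: regular_cst.
- exact: reg_s.
- exact: regularD.
- exact: regularM.
Qed.

Lemma regular_preimage D x : zopen D -> U x -> D (s x) ->
  exists D', [/\ zopen D', D' x & forall y, U y -> D' y -> D (s y)].
Proof.
move=> /zopenP[I ->] Ux [p Ip px].
have [D' [zO' D'x h]] := regular_neq0 (regular_comp_polyfun (polyfun_peval p)) Ux px.
by exists D'; split=> // y Uy D'y; exists p => //; exact: h.
Qed.

Lemma regular_comp A f : (forall x, U x -> A (s x)) -> regular A f ->
  regular U (f \o s).
Proof.
move=> UA hf; apply: regular_local => x Ux.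
have [D [p [q [zO Ox hpq]]]] := hf _ (UA _ Ux).
have [D' [zO' D'x hO']] := regular_preimage zO Ux Ox.
exists D'; split=> //.
have sub : U `&` D' `<=` U by move=> y [].
apply: (@eq_regular _ _ _ (fun y => (peval p \o s) y * ((peval q \o s) y)^-1)).
  move=> y [Uy D'y]; have [_ /= ->] := hpq _ (UA _ Uy) (hO' _ Uy D'y).
  by [].
apply: regularM; first by apply/(regular_sub sub)/regular_comp_polyfun/polyfun_peval.
apply: regularV; first by apply/(regular_sub sub)/regular_comp_polyfun/polyfun_peval.
by move=> y [Uy D'y]; have [] := hpq _ (UA _ Uy) (hO' _ Uy D'y).
Qed.

End RegularComposition.

(** * Morphisms, quasi-affine varieties and quotients from local sections *)

Section ZariskiSpaces.
Variable K : closedFieldType.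

Lemma regular_morphism m n (Z : set 'rV[K]_m) (Z' : set 'rV[K]_n)
    (s : 'rV[K]_m -> 'rV[K]_n) :
  (forall x, Z x -> Z' (s x)) -> (forall i, regular Z (fun x => s x 0 i)) ->
  @morphism K (zariski Z) (zariski Z') s.
Proof.
move=> ZZ' hs; split=> //.
  move=> W [D zO WE]; apply: relopenP; first by move=> x [].
  move=> x [Zx]; rewrite /preimage /= WE => -[_ Ox].
  have [D' [zO' D'x h]] := regular_preimage hs zO Zx Ox.
  by exists D'; split=> // y [Zy D'y]; split=> //=; split; [exact: ZZ'|exact: h].
move=> W h [D zO WE] hh; apply: (@regular_comp _ _ _ _ _ _ W) hh; last by move=> x [].
by move=> i; apply: regular_sub (hs i) => x [].
Qed.

Lemma morphism_regular (X : funspace K) n (Z : set 'rV[K]_n) (f : pt X -> 'rV[K]_n) i :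
  @morphism K X (zariski Z) f -> @reg K X (@dom K X `&` f @^-1` Z) (fun x => f x 0 i).
Proof.
move=> [_ _ h]; apply: (h Z (fun x => x 0 i)).
  by exists setT; [exact: zopenT|rewrite setIT].
apply: regular_polyfun; exact: polyfun_coord.
Qed.

Lemma is_space_zariski n (Z : set 'rV[K]_n) : is_space (zariski Z).
Proof.
split.
- by move=> U [D _ ->] x [].
- by exists setT; [exact: zopenT|rewrite setIT].
- move=> U W [D zO ->] [D' zO' ->]; exists (D `&` D'); first exact: zopenI.
  by rewrite setIACA setIid.
- move=> F hF; apply: relopenP => [x [U /hF[D _ ->] []]//|x [U FU Ux]].
  have [D zO UE] := hF _ FU; exists D; split=> //; first by move: Ux; rewrite UE => -[].
  by move=> y Zy; exists U => //; rewrite UE.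
- by move=> U f f' _; exact: eq_regular.
move=> F f hF; split=> [h U FU|h].
  by apply: regular_sub h => x Ux; exists U.
apply: regular_local => x [U FU Ux]; have [D zO UE] := hF _ FU.
exists D; split=> //; first by move: Ux; rewrite UE => -[].
apply: regular_sub (h U FU) => y [[U' FU' U'y] Oy]; rewrite UE; split=> //.
by move: U'y; have [D' _ ->] := hF _ FU' => -[].
Qed.

Lemma zclosed_regular_eq0 n (Z : set 'rV[K]_n) f :
  zclosed Z -> regular Z f -> zclosed [set x | Z x /\ f x = 0].
Proof.
move=> /zclosedC cZ rf; rewrite zclosedC.
suff [D zO E] : relopen setT (~` [set x | Z x /\ f x = 0]) by rewrite E setTI.
apply: relopenP => // x; have [Zx|NZx] := pselect (Z x); last first.
  move=> _; exists (~` Z); split=> // y [_ NZy] [Zy _]; exact: NZy.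
move=> h; have fx : f x != 0 by apply/eqP => fx; apply: h.
have [D [zO Ox hO]] := regular_neq0 rf Zx fx; exists D; split=> // y [_ Oy] [Zy].
by apply/eqP; exact: hO.
Qed.

(** The coincidence set of two morphisms is cut out by the differences of their coordinates, which
    are regular; the list induction forms the finite intersection. *)
Lemma separated_zariski n (Z : set 'rV[K]_n) : separated (zariski Z).
Proof.
move=> m Y f g cY mf mg.
have rf i : regular Y (fun x => f x 0 i).
  have := morphism_regular i mf; rewrite /=; apply: regular_sub => x Yx.
  by split=> //; case: mf => h _ _; exact: h.
have rg i : regular Y (fun x => g x 0 i).
  have := morphism_regular i mg; rewrite /=; apply: regular_sub => x Yx.
  by split=> //; case: mg => h _ _; exact: h.
have H (r : seq 'I_n) : zclosed [set z | Y z /\ forall i, i \in r -> f z 0 i = g z 0 i].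
  elim: r => [|i r IH].
    by rewrite (_ : [set z | _] = Y) // predeqE => x; split=> [[]|Yx] //; split.
  apply: eq_ind (zclosedI (zclosed_regular_eq0 cY (regularB (rf i) (rg i))) IH) _ _.
  rewrite predeqE => x; split.
    move=> [[Yx /eqP]]; rewrite subr_eq0 => /eqP e [_ h]; split=> // j.
    by rewrite in_cons => /orP[/eqP->|/h].
  move=> [Yx h]; split; split=> //; first by rewrite h ?subrr // mem_head.
  by move=> j jr; apply: h; rewrite in_cons jr orbT.
apply: eq_ind (H (enum 'I_n)) _ _; rewrite predeqE => x.
split=> -[Yx h]; split=> //; last by move=> i _; rewrite h.
by apply/rowP => i; apply: h; rewrite mem_enum.
Qed.

(** Rabinowitsch's trick: x |-> (x, 1/f(x)) maps the open set isomorphically onto the closed set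
    f(x) z = 1 in one more dimension. [Y] is the surrounding set, possibly not closed, whose
    topology is restricted. *)
Lemma affine_principal_open n (Y Z : set 'rV[K]_n) f : zclosed Z -> polyfun f ->
  Z `&` [set x | f x != 0] `<=` Y ->
  relopen Y (Z `&` [set x | f x != 0]) ->
  affine (@restrict K (zariski Y) (Z `&` [set x | f x != 0])).
Proof.
move=> cZ pf; set U := Z `&` _ => UY oU.
pose Z' : set 'rV[K]_(n + 1) :=
  [set z | Z (lsubmx z) /\ f (lsubmx z) * z 0 (rshift n 0) - 1 = 0].
have pl i : polyfun (fun z : 'rV[K]_(n + 1) => lsubmx z 0 i).
  by under eq_fun do rewrite mxE; exact: polyfun_coord.
exists (n + 1)%N, Z'; split.
  have -> : Z' = [set z | Z (lsubmx z)] `&`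
      [set z | f (lsubmx z) * z 0 (rshift n 0) - 1 = 0] by [].
  apply: zclosedI.
    have [I ->] := cZ; rewrite (_ : mkset _ =
      [set z | forall p, (fun q => exists2 r, I r & peval q = peval r \o lsubmx) p ->
        peval p z = 0]); first by eexists.
    rewrite predeqE => z; split=> [h p [r Ir ->]|h p Ip]; first exact: h.
    have [q qE] := polyfun_comp pl (polyfun_peval p).
    by rewrite -[LHS]/((peval p \o lsubmx) z) qE; apply: h; exists p.
  apply/zclosed_eq0/polyfunB; last exact: polyfun_cst.
  by apply: polyfunM; [exact: polyfun_comp|exact: polyfun_coord].
pose s (x : 'rV[K]_n) : 'rV[K]_(n + 1) := row_mx x (const_mx (f x)^-1).
have sl i x : s x 0 (lshift 1 i) = x 0 i by rewrite /s row_mxEl.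
have sr i x : s x 0 (rshift n i) = (f x)^-1 by rewrite /s row_mxEr mxE.
have rs i : regular U (fun x => s x 0 i).
  case: (splitP i) => j ji.
    have -> : i = lshift 1 j by apply/val_inj.
    by under eq_fun do rewrite sl; apply/regular_polyfun/polyfun_coord.
  have -> : i = rshift n j by apply/val_inj.
  under eq_fun do rewrite sr; apply: regularV; first exact: regular_polyfun.
  by move=> x [].
have UZ' x : U x -> Z' (s x).
  move=> [Zx /= fx]; rewrite /Z' /= row_mxKl; split=> //.
  by rewrite sr divff // subrr.
have Z'U z : Z' z -> U (lsubmx z).
  move=> [Zz /eqP]; rewrite subr_eq0 => /eqP h; split=> //=; apply/eqP => fz.
  by move: h; rewrite fz mul0r => /eqP; rewrite eq_sym oner_eq0.
exists s; split; last first.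
  exists (@lsubmx K 1 n 1); split.
  - have [h1 h2 h3] : @morphism K (zariski Z') (zariski Y) (@lsubmx K 1 n 1).
      apply: regular_morphism => [z /Z'U/UY//|i].
      exact: regular_polyfun.
    split=> [z /Z'U//|W [oW _]|W h [oW _]]; [exact: h2|exact: h3].
  - by move=> x _; rewrite /s row_mxKl.
  - move=> z [_ /eqP]; rewrite subr_eq0 => /eqP h; apply/rowP => i.
    case: (splitP i) => j ji.
      have -> : i = lshift 1 j by apply/val_inj.
      by rewrite sl mxE.
    have -> : i = rshift n j by apply/val_inj.
    rewrite sr (ord1 j); apply: (@mulfI _ (f (lsubmx z))).
      by apply/eqP => fz; move: h; rewrite fz mul0r => /eqP; rewrite eq_sym oner_eq0.
    rewrite h divff //.
    by apply/eqP => fz; move: h; rewrite fz mul0r => /eqP; rewrite eq_sym oner_eq0.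
split=> //.
  move=> W [D zO WE]; split; last by move=> x [].
  have [D1 zO1 UE] := oU; apply: relopenP => [x [/UY]//|x [Ux sx]].
  have Ox : D (s x) by move: sx; rewrite /preimage /= WE => -[].
  have [D' [zO' D'x h]] := regular_preimage rs zO Ux Ox.
  exists (D1 `&` D'); split; first exact: zopenI.
    by split=> //; move: Ux; rewrite UE => -[].
  move=> y [Yy [D1y D'y]]; have Uy : U y by rewrite UE.
  by split=> //=; rewrite WE; split; [exact: UZ'|exact: h].
move=> W h [D zO WE] hh; apply: (@regular_comp _ _ _ _ _ _ W) hh; last by move=> x [].
by move=> i; apply: regular_sub (rs i) => x [].
Qed.

Definition quasi_affine n k (Q : set 'rV[K]_n) (F : 'I_k -> 'rV[K]_n -> K) : set 'rV[K]_n :=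
  [set x | Q x /\ exists i, F i x != 0].

Lemma variety_quasi_affine n k (Q : set 'rV[K]_n) (F : 'I_k -> 'rV[K]_n -> K) :
  zclosed Q -> (forall i, polyfun (F i)) -> variety (zariski (quasi_affine Q F)).
Proof.
move=> cQ pF; split; [exact: is_space_zariski| |exact: separated_zariski].
have sub i : Q `&` [set x | F i x != 0] `<=` quasi_affine Q F.
  by move=> x [Qx Fx]; split=> //; exists i.
have op i : relopen (quasi_affine Q F) (Q `&` [set x | F i x != 0]).
  exists [set x | F i x != 0]; first exact: zopen_neq0.
  by rewrite predeqE => x; split=> [[Qx Fx]|[[Qx _] Fx]]; split=> //; split=> //; exists i.
exists k, (fun i => Q `&` [set x | F i x != 0]); split=> //; last first.
  by move=> i; exact: affine_principal_open.
rewrite predeqE => x; split=> [[Qx [i Fx]]|[i _ [Qx Fx]]]; first by exists i.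
by split=> //; exists i.
Qed.

(** Regular sections over an open cover of the base provide descent: open sets and invariant
    functions upstairs are pulled back along a section, and the result does not depend on the
    section because the fibres are orbits. *)
Lemma geometric_quotient_of_sections (A : Type) (L : set A) m n k
    (act : A -> 'rV[K]_m -> 'rV[K]_m) (pi : 'rV[K]_m -> 'rV[K]_n)
    (Q : set 'rV[K]_n) (F : 'I_k -> 'rV[K]_n -> K)
    (s : 'I_k -> 'rV[K]_n -> 'rV[K]_m) :
  zclosed Q -> (forall i, polyfun (F i)) -> (forall j, polyfun (fun x => pi x 0 j)) ->
  (forall x, quasi_affine Q F (pi x)) ->
  (forall i j, regular (Q `&` [set y | F i y != 0]) (fun y => s i y 0 j)) ->
  (forall i y, Q y -> F i y != 0 -> pi (s i y) = y) ->
  (forall x x', pi x = pi x' <-> exists2 l, L l & act l x = x') ->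
  @geometric_quotient K A (zariski [set: 'rV[K]_m]) L act
    (zariski (quasi_affine Q F)) pi.
Proof.
move=> cQ pF ppi piY rs pis fib.
have mpi : @morphism K (zariski [set: 'rV[K]_m]) (zariski (quasi_affine Q F)) pi.
  by apply: regular_morphism => // i; exact: regular_polyfun.
have preim W i y : relopen setT (setT `&` pi @^-1` W) -> Q y -> F i y != 0 -> W y ->
  exists D, [/\ zopen D, D y, (forall z, D z -> F i z != 0) &
     forall z, Q z -> D z -> W z].
  move=> [D zO WE] Qy Fy Wy.
  have WO x : W (pi x) <-> D x.
    have : (setT `&` pi @^-1` W) x <-> (setT `&` D) x by rewrite WE.
    by rewrite !setTI.
  have Oy : D (s i y) by apply/WO; rewrite pis.
  have [D' [zO' D'y h]] := regular_preimage (rs i) zO (conj Qy Fy) Oy.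
  exists (D' `&` [set y | F i y != 0]); split=> //.
  - by apply: zopenI => //; exact: zopen_neq0.
  - by move=> z [].
  - by move=> z Qz [D'z Fz]; rewrite -(pis i z) //; apply/WO/h.
split=> //.
- exact: variety_quasi_affine.
- by move=> y [Qy [i Fy]]; exists (s i y) => //; exact: pis.
- move=> W WY; split=> [rW|rW]; first by case: mpi => _ h _; exact: h.
  apply: relopenP => // y Wy; have [Qy [i Fy]] := WY y Wy.
  have [D [zO Oy _ h]] := preim W i y rW Qy Fy Wy; exists D; split=> //.
  by move=> z [[Qz _] Oz]; exact: h.
move=> W phi oW rphi inv.
have WY : W `<=` quasi_affine Q F by case: oW => D _ -> x [].
have phiE x x' : W (pi x) -> pi x = pi x' -> phi x' = phi x.
  by move=> Wx /fib[l Ll <-]; apply: inv.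
(* Any section defined at y gives the same value; outside the charts the default is 0. *)
pose f y := if [pick i | F i y != 0] is Some i then phi (s i y) else 0.
have fE i y : W y -> F i y != 0 -> f y = phi (s i y).
  move=> Wy Fy; have [Qy _] := WY _ Wy; rewrite /f; case: pickP => [j Fj|/(_ i)].
    by apply: phiE; rewrite !pis.
  by rewrite Fy.
exists f; last first.
  move=> x [_ Wx]; have [Qx [i Fx]] := WY _ Wx.
  by rewrite (fE i) //; apply: phiE; rewrite pis.
apply: regular_local => y Wy; have [Qy [i Fy]] := WY _ Wy.
exists [set y | F i y != 0]; split=> //; first exact: zopen_neq0.
apply: (@eq_regular _ _ _ (phi \o s i)).
  by move=> z [Wz Fz]; rewrite (fE i).
apply: (@regular_comp _ _ _ _ _ _ (setT `&` pi @^-1` W)) rphi.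
  by move=> j; apply: regular_sub (rs i j) => z [/WY[Qz _] Fz].
by move=> z [Wz Fz]; split=> //=; rewrite pis //; have [] := WY _ Wz.
Qed.

End ZariskiSpaces.

(** * Regular functions in the Euclidean topology *)

Section ComplexTopology.
Variable R : realType.
Local Notation C := (Cplx R).

Lemma cvg_rV (K : topologicalType) (T : Type) (F : set_system T) n
    (f : T -> 'rV[K]_n) (y : 'rV[K]_n) : Filter F ->
  (forall i, (fun t => f t 0 i) @ F --> y 0 i) -> f @ F --> y.
Proof.
move=> FF h A [P hP sPA].
have : \forall t \near F, forall i, P 0 i (f t 0 i).
  by apply: filter_forall => i; exact: h (hP 0 i).
by apply: filterS => t ht; apply: sPA => i j; rewrite (ord1 i).
Qed.

Lemma continuous_polyfun n (f : 'rV[C]_n -> C) : polyfun f -> continuous f.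
Proof.
move=> hf; elim/polyfun_ind: hf => [c|i|g h cg ch|g h cg ch] x.
- exact: cst_continuous.
- exact: coord_continuous.
- by apply: continuousD; [exact: cg|exact: ch].
- by apply: continuousM; [exact: cg|exact: ch].
Qed.

Lemma open_neq0 : open [set z : C | z != 0].
Proof.
rewrite (_ : mkset _ = ~` [set 0]); last by rewrite predeqE => z; split=> /eqP.
apply: closed_openC; apply: accessible_closed_set1; apply: hausdorff_accessible.
exact: norm_hausdorff.
Qed.

Lemma zopen_open n (D : set 'rV[C]_n) : zopen D -> open D.
Proof.
move=> /zopenP[I ->]; rewrite (_ : mkset _ =
  \bigcup_(p in I) ((@peval C n p) @^-1` [set z : C | z != 0])).
  apply: bigcup_open => p _; apply: open_comp; last exact: open_neq0.
  by move=> x _; apply: continuous_polyfun; exact: polyfun_peval.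
by rewrite predeqE => x; split=> -[p]; exists p.
Qed.

Lemma zclosed_closed n (Z : set 'rV[C]_n) : zclosed Z -> closed Z.
Proof. by move=> /zclosedC /zopen_open; rewrite -closedC setCK. Qed.

Lemma differentiable_polyfun n (f : 'rV[C]_n -> C) x :
  polyfun f -> differentiable f x.
Proof.
move=> hf; elim/polyfun_ind: hf => [c|i|g h cg ch|g h cg ch].
- exact: differentiable_cst.
- exact: differentiable_coord.
- exact: differentiableD.
- exact: differentiableM.
Qed.

(** Common ground for regular functions and for [holomorphic] maps, both of which are given through
    local representatives. *)
Definition ldiff n (f : 'rV[C]_n -> C) x :=
  exists2 g, differentiable g x & {near x, f =1 g}.

Lemma regular_ldiff n (f : 'rV[C]_n -> C) x : regular setT f -> ldiff f x.
Proof.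
move=> hf; have [D [p [q [zD Dx h]]]] := hf x I.
have nD : nbhs x D by apply: open_nbhs_nbhs; split=> //; exact: zopen_open.
exists (fun y => peval p y * (peval q y)^-1).
  apply: differentiableM; first by apply/differentiable_polyfun/polyfun_peval.
  apply: differentiableV; last by have [] := h x I Dx.
  by apply/differentiable_polyfun/polyfun_peval.
by apply: filterS nD => y Dy; have [_ ->] := h y I Dy.
Qed.

Lemma ldiff_continuous n (f : 'rV[C]_n -> C) x : ldiff f x -> {for x, continuous f}.
Proof.
move=> [g dg fg]; have fx : f x = g x by exact: nbhs_singleton fg.
rewrite /continuous_at /prop_for fx.
apply: cvg_trans (differentiable_continuous dg).
apply: (@near_eq_cvg _ _ (nbhs x)); by apply: filterS fg => y ->.
Qed.

Lemma ldiff_line n (f : 'rV[C]_n -> C) (v w : 'rV[C]_n) (t : C) :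
  ldiff f (t *: w + v) -> differentiable (fun s : C => f (s *: w + v)) t.
Proof.
move=> [g dg fg].
have dl : differentiable (fun s : C => s *: w + v) t.
  apply: differentiableD; last exact: differentiable_cst.
  by apply: differentiableZl.
apply/derivable1_diffP.
apply: (@near_eq_derivable _ _ _ (g \o (fun s : C => s *: w + v))); last first.
  by apply/derivable1_diffP; apply: differentiable_comp.
have near_t := differentiable_continuous dl fg.
by apply: (@filterS _ (nbhs t) _ _ _ _ near_t) => s /= ->.
Qed.

Lemma nc_continuous : continuous (@nc R).
Proof.
move=> z; apply/(@cvgrPdist_lt _ _ _ (nbhs z)) => e e0.
have e0' : 0 < real_complex R e by rewrite ltr0C.
have near_z : nbhs z (ball z (real_complex R e)) by exact: nbhsx_ballx.
apply: (@filterS _ (nbhs z) _ _ _ _ near_z) => w; rewrite /ball /= normE ltcR => h.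
have h1 := ncD (z - w) w; have h2 := ncD (w - z) z; move: h1 h2 h.
by rewrite !subrK (ncBC w z) ltr_norml => h1 h2 h; apply/andP; split; lra.
Qed.

Lemma complex_continuous : continuous (fun p : R * R => (p.1 +i* p.2)%C : C).
Proof.
move=> [x y]; apply/(@cvgrPdist_lt _ _ _ (nbhs (x, y))) => e e0.
have eE : e = real_complex R (re e) by rewrite RRe_real //; exact: gtr0_real.
have e2 : 0 < re e / 2 by rewrite divr_gt0 // -ltr0C -eE.
exists (ball x (re e / 2), ball y (re e / 2)).
  by split; apply: nbhsx_ballx.
move=> [x' y'] [/= hx hy]; rewrite eE normE ltcR.
apply: le_lt_trans (nc_le_reim _) _; rewrite /re /im /=.
by move: hx hy; rewrite /ball /= => hx hy; have := ltrD hx hy; rewrite -splitr.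
Qed.

Lemma compact_square (M : R) : compact [set z : C | `|re z| <= M /\ `|im z| <= M].
Proof.
rewrite (_ : mkset _ = (fun p : R * R => (p.1 +i* p.2)%C : C) @`
    (`[- M, M]%classic `*` `[- M, M]%classic)).
  apply: continuous_compact; last by apply: compact_setX; exact: segment_compact.
  by apply: continuous_subspaceT; exact: complex_continuous.
rewrite predeqE => -[x y]; split=> [[hx hy]|[[x' y'] [/= + +] [<- <-]]].
  exists (x, y) => //; split=> /=; by rewrite in_itv /= -ler_norml.
by rewrite !in_itv /= -!ler_norml.
Qed.

Lemma compact_polydisc n (M : R) : compact [set v : 'rV[C]_n | forall i, nc (v 0 i) <= M].
Proof.
apply: (@subclosed_compact _ _
  [set v : 'rV[C]_n | forall i, [set z : C | `|re z| <= M /\ `|im z| <= M] (v 0 i)]).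
- rewrite (_ : mkset _ = \bigcap_(i : 'I_n) ((fun v : 'rV[C]_n => nc (v 0 i)) @^-1`
      [set r : R | r <= M])).
    apply: closed_bigI => i _; apply: preimage_closed; last exact: closed_le.
    move=> v _; apply: (@continuous_comp _ _ _ (fun v : 'rV[C]_n => v 0 i)).
      exact: coord_continuous.
    exact: nc_continuous.
  by rewrite predeqE => v; split=> h i *; exact: h.
- apply: (@rV_compact C n (fun=> [set z : C | `|re z| <= M /\ `|im z| <= M])) => _.
  exact: compact_square.
- by move=> v h i; split; apply: le_trans (h i); [exact: re_le_nc|exact: im_le_nc].
Qed.

(** Euclidean continuity of a regular function, stated for filters containing [Z] because nothing is
    known of [f] outside [Z]. *)
Lemma regular_cvg n (Z : set 'rV[C]_n) (f : 'rV[C]_n -> C) (c : 'rV[C]_n)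
    (G : set_system 'rV[C]_n) : Filter G -> regular Z f -> Z c -> G Z -> G --> c ->
  f @ G --> f c.
Proof.
move=> FG rf Zc GZ Gc; have [D [p [q [zD Dc h]]]] := rf c Zc.
have [qc ->] := h c Zc Dc.
have GD : G D by apply: Gc; apply: open_nbhs_nbhs; split=> //; exact: zopen_open.
have cp (r : mpoly.mpoly n C) : peval r y @[y --> c] --> peval r c.
  by apply: continuous_polyfun; exact: polyfun_peval.
have quot : (fun y => peval p y * (peval q y)^-1) @ G --> peval p c * (peval q c)^-1.
  apply: cvgM; last apply: cvgV => //.
    exact: cvg_trans (cvg_app (peval p) Gc) (cp p).
  exact: cvg_trans (cvg_app (peval q) Gc) (cp q).
apply: cvg_trans quot; apply: near_eq_cvg.
by apply: filterS2 GZ GD => y Zy Dy; have [_ ->] := h y Zy Dy.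
Qed.

End ComplexTopology.

(** * The action in coordinates *)

Lemma ord8P (P : 'I_8 -> Prop) : P iX1 -> P iX2 -> P iY1 -> P iY2 -> P iY3 ->
  P iY4 -> P iZ1 -> P iZ2 -> forall i, P i.
Proof.
move=> h1 h2 h3 h4 h5 h6 h7 h8 [i hi].
case: i hi => [|[|[|[|[|[|[|[|//]]]]]]]] hi.
- by rewrite (_ : Ordinal hi = iX1) //; exact/val_inj.
- by rewrite (_ : Ordinal hi = iX2) //; exact/val_inj.
- by rewrite (_ : Ordinal hi = iY1) //; exact/val_inj.
- by rewrite (_ : Ordinal hi = iY2) //; exact/val_inj.
- by rewrite (_ : Ordinal hi = iY3) //; exact/val_inj.
- by rewrite (_ : Ordinal hi = iY4) //; exact/val_inj.
- by rewrite (_ : Ordinal hi = iZ1) //; exact/val_inj.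
- by rewrite (_ : Ordinal hi = iZ2) //; exact/val_inj.
Qed.

Section ExampleCoordinates.
Variable C : numClosedFieldType.
Local Notation g := 'rV[C]_8.
Implicit Types (x y : g).

Definition row8 (a1 a2 a3 a4 a5 a6 a7 a8 : C) : g :=
  \row_(i < 8) nth 0 [:: a1; a2; a3; a4; a5; a6; a7; a8] i.

Lemma row8_ext x y : x 0 iX1 = y 0 iX1 -> x 0 iX2 = y 0 iX2 ->
  x 0 iY1 = y 0 iY1 -> x 0 iY2 = y 0 iY2 -> x 0 iY3 = y 0 iY3 ->
  x 0 iY4 = y 0 iY4 -> x 0 iZ1 = y 0 iZ1 -> x 0 iZ2 = y 0 iZ2 -> x = y.
Proof.
by move=> *; apply/rowP; elim/ord8P.
Qed.

Definition vel (a b : C) : g := row8 a b 0 0 0 0 a b.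
Definition hel (c d : C) : g := row8 c d 0 0 0 0 0 0.

Lemma mem_hh x : x \in hh C <-> exists c d, x = hel c d.
Proof.
rewrite /hh span_cons span_seq1; split.
  move=> /memv_addP[_ /vlineP[c ->]] [_ /vlineP[d ->] ->]; exists c, d.
  by apply: row8_ext; rewrite !mxE /=; ring.
move=> [c [d ->]]; apply/memv_addP; exists (c *: vec C iX1); first exact/memvZ/memv_line.
exists (d *: vec C iX2); first exact/memvZ/memv_line.
by apply: row8_ext; rewrite !mxE /=; ring.
Qed.

Lemma mem_vv x : x \in vv C <-> exists a b, x = vel a b.
Proof.
rewrite /vv span_cons span_seq1; split.
  move=> /memv_addP[_ /vlineP[a ->]] [_ /vlineP[b ->] ->]; exists a, b.
  by apply: row8_ext; rewrite !mxE /=; ring.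
move=> [a [b ->]]; apply/memv_addP; exists (a *: (vec C iX1 + vec C iZ1)).
  exact/memvZ/memv_line.
exists (b *: (vec C iX2 + vec C iZ2)); first exact/memvZ/memv_line.
by apply: row8_ext; rewrite !mxE /=; ring.
Qed.

Lemma VgrpP x : Vgrp C x <-> exists a b, x = vel a b.
Proof. by rewrite -mem_vv; split=> [[y yv <-]|xv]//; exists x. Qed.

Lemma HgrpP x : Hgrp C x <-> exists c d, x = hel c d.
Proof. by rewrite -mem_hh; split=> [[y yv <-]|xv]//; exists x. Qed.

Lemma VHP l : VH C l <-> exists a b c d, l = (vel a b, hel c d).
Proof.
case: l => v h; split; rewrite /VH.
  by move=> [/= /VgrpP[a [b ->]] /HgrpP[c [d ->]]]; exists a, b, c, d.
by move=> [a [b [c [d [-> ->]]]]]; split; [apply/VgrpP; exists a, b|apply/HgrpP; exists c, d].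
Qed.

(* The coordinates of n in the decomposition x = n exp(x_1 X_1 + x_2 X_2),
   where n lies in the abelian ideal spanned by the Y_i and Z_i; the
   coordinates of n on Y_1 and Y_2 are those of x. *)
Definition nY3 x : C := x 0 iY3 + 2^-1 * (x 0 iX1 * x 0 iY2 + x 0 iX2 * x 0 iY1).
Definition nY4 x : C := x 0 iY4 + 2^-1 * (x 0 iX2 * x 0 iY2).
Definition nZ1 x : C := x 0 iZ1 + 2^-1 * (x 0 iX2 * x 0 iZ2) +
  6^-1 * (x 0 iX2 ^+ 2 * x 0 iY1).
Definition nZ2 x : C := x 0 iZ2 + 2^-1 * (x 0 iX2 * x 0 iY1).

(** The change of coordinates is triangular; [nZ1] involves the coordinate on Z_2, so [nZ2] has to
    be resolved before it. *)
Lemma ncoord_ext x y : x 0 iX1 = y 0 iX1 -> x 0 iX2 = y 0 iX2 ->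
  x 0 iY1 = y 0 iY1 -> x 0 iY2 = y 0 iY2 -> nY3 x = nY3 y ->
  nY4 x = nY4 y -> nZ1 x = nZ1 y -> nZ2 x = nZ2 y -> x = y.
Proof.
rewrite /nY3 /nY4 /nZ1 /nZ2 => e1 e2 e3 e4; rewrite e1 e2 e3 e4.
move=> /addIr e5 /addIr e6 /addIr + /addIr e8; rewrite e8 => /addIr e7.
exact: row8_ext.
Qed.

Section ActionCoordinates.
Variables (a b c d : C) (x : g).
Let x' := act (vel a b, hel c d) x.

Lemma act_X1 : x' 0 iX1 = x 0 iX1 + a - c.
Proof. by rewrite /x' /act !gmulE /wedge !gmulE /wedge /ginv !mxE /=; ring. Qed.

Lemma act_X2 : x' 0 iX2 = x 0 iX2 + b - d.
Proof. by rewrite /x' /act !gmulE /wedge !gmulE /wedge /ginv !mxE /=; ring. Qed.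

Lemma act_Y1 : x' 0 iY1 = x 0 iY1.
Proof. by rewrite /x' /act !gmulE /wedge !gmulE /wedge /ginv !mxE /=; ring. Qed.

Lemma act_Y2 : x' 0 iY2 = x 0 iY2.
Proof. by rewrite /x' /act !gmulE /wedge !gmulE /wedge /ginv !mxE /=; ring. Qed.

Lemma act_nY3 : nY3 x' = nY3 x + a * x 0 iY2 + b * x 0 iY1.
Proof.
by rewrite /nY3 act_X1 act_X2 act_Y1 act_Y2 /x' /act !gmulE /wedge !gmulE /wedge /ginv !mxE /=; field.
Qed.

Lemma act_nY4 : nY4 x' = nY4 x + b * x 0 iY2.
Proof.
by rewrite /nY4 act_X2 act_Y2 /x' /act !gmulE /wedge !gmulE /wedge /ginv !mxE /=; field.
Qed.

Lemma act_nZ2 : nZ2 x' = nZ2 x + b * (x 0 iY1 + 1).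
Proof.
by rewrite /nZ2 act_X2 act_Y1 /x' /act !gmulE /wedge !gmulE /wedge /ginv !mxE /=; field.
Qed.

(** Along the flow of X_2 + Z_2 with time b, [nZ1] has derivative [nZ2], which has the constant
    derivative y_1 + 1; hence the quadratic term. *)
Lemma act_nZ1 : nZ1 x' = nZ1 x + a + b * nZ2 x + b ^+ 2 * (x 0 iY1 + 1) / 2.
Proof.
by rewrite /nZ1 /nZ2 act_X2 act_Y1 /x' /act !gmulE /wedge !gmulE /wedge /ginv !mxE /=; field.
Qed.

End ActionCoordinates.

Definition act_coord := (act_X1, act_X2, act_Y1, act_Y2, act_nY3, act_nY4, act_nZ2, act_nZ1).

(* Eliminating X_1 + Z_1 by nZ1 = 0 turns nY3 into iu, and X_2 + Z_2 then acts on
   (nY4, nZ2, iu) through the locally nilpotent derivation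
   nY4 |-> y_2, nZ2 |-> t, iu |-> t - 1 - y_2 nZ2, where t = it x and y_2 = x_{Y_2}.
   Its kernel contains t, y_2, ip, iq, ir, which satisfy the quadratic relation
   t ir - y_2 iq = ip (2 - ip) / 2. *)
Definition it x : C := x 0 iY1 + 1.
Definition ip x : C := it x * nY4 x - x 0 iY2 * nZ2 x.
Definition iu x : C := nY3 x - x 0 iY2 * nZ1 x.
Definition iq x : C := it x * iu x + x 0 iY2 * nZ2 x ^+ 2 / 2 - (it x - 1) * nZ2 x.
Definition ir x : C := x 0 iY2 * iu x - (it x - 1) * nY4 x + x 0 iY2 * nY4 x * nZ2 x -
  it x * nY4 x ^+ 2 / 2 + ip x.

Definition quot_map x : 'rV[C]_5 :=
  \row_(i < 5) nth 0 [:: it x; x 0 iY2; ip x; iq x; ir x] i.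

Lemma it_act l x : VH C l -> it (act l x) = it x.
Proof. by move=> /VHP[a [b [c [d ->]]]]; rewrite /it act_Y1. Qed.

Lemma iY2_act l x : VH C l -> act l x 0 iY2 = x 0 iY2.
Proof. by move=> /VHP[a [b [c [d ->]]]]; rewrite act_Y2. Qed.

Lemma ip_act l x : VH C l -> ip (act l x) = ip x.
Proof. by move=> /VHP[a [b [c [d ->]]]]; rewrite /ip /it !act_coord; ring. Qed.

Lemma iq_act l x : VH C l -> iq (act l x) = iq x.
Proof.
by move=> /VHP[a [b [c [d ->]]]]; rewrite /iq /iu /it !act_coord; field.
Qed.

Lemma ir_act l x : VH C l -> ir (act l x) = ir x.
Proof.
by move=> /VHP[a [b [c [d ->]]]]; rewrite /ir /ip /iu /it !act_coord; field.
Qed.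

(* The group element carrying x to x' when these lie in the same orbit: its
   coordinates are polynomials in (x, x'), whence properness and freeness. *)
Definition orb_b x x' : C := nZ2 x' - nZ2 x - (nZ2 x + nZ2 x') / 2 * (nY4 x' - nY4 x) -
  (nY3 x' - nY3 x - x 0 iY2 * (nZ1 x' - nZ1 x)).
Definition orb_a x x' : C := nZ1 x' - nZ1 x - orb_b x x' * ((nZ2 x + nZ2 x') / 2).
Definition orb_c x x' : C := x 0 iX1 + orb_a x x' - x' 0 iX1.
Definition orb_d x x' : C := x 0 iX2 + orb_b x x' - x' 0 iX2.
Definition orb_elt x x' : g * g :=
  (vel (orb_a x x') (orb_b x x'), hel (orb_c x x') (orb_d x x')).

Lemma VH_orb_elt x x' : VH C (orb_elt x x').
Proof. by apply/VHP; do 4!eexists. Qed.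

Lemma orb_elt_act l x : VH C l -> orb_elt x (act l x) = l.
Proof.
move=> /VHP[a [b [c [d ->]]]]; rewrite /orb_elt /orb_c /orb_d.
(* With m the mean of the two values of [nZ2], the differences of [nZ2], [nY4] and [iu] are bt, b
   y_2 and b(t - 1 - y_2 m), and bt - m b y_2 - b(t - 1 - y_2 m) = b. Likewise [nZ1] grows by a +
   bm. *)
have bE : orb_b x (act (vel a b, hel c d) x) = b.
  by rewrite /orb_b !act_coord; field.
have aE : orb_a x (act (vel a b, hel c d) x) = a.
  by rewrite /orb_a bE !act_coord; field.
rewrite aE bE !act_coord; congr pair; congr hel; ring.
Qed.

(** Derives an equation by writing the difference of its sides as a combination [w] of known
    relations: the identity goes to [ring] or [field], and [w] vanishes by rewriting. *)
Lemma eq_by_sub (u v w : C) : u - v = w -> w = 0 -> u = v.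
Proof. by move=> <- /eqP; rewrite subr_eq0 => /eqP. Qed.

(** Equal invariants amount to three relations [hp], [hq], [hr] between the differences of
    coordinates, and suitable combinations of these say that [orb_b] solves the orbit equations.
    Nothing is divided by t or y_2, so their zeros need no separate treatment. *)
Lemma act_orb_elt x x' : it x = it x' -> x 0 iY2 = x' 0 iY2 -> ip x = ip x' ->
  iq x = iq x' -> ir x = ir x' -> act (orb_elt x x') x = x'.
Proof.
move=> et ey ep eq er; have ey1 : x 0 iY1 = x' 0 iY1 by apply: (addIr 1).
set b := orb_b x x'; set m := (nZ2 x + nZ2 x') / 2; set n := (nY4 x + nY4 x') / 2.
pose E := nY3 x' - nY3 x - x 0 iY2 * (nZ1 x' - nZ1 x).
have hp : it x * (nY4 x' - nY4 x) - x 0 iY2 * (nZ2 x' - nZ2 x) = 0.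
  apply: (eq_by_sub (w := ip x' - ip x)); last by rewrite ep subrr.
  by rewrite /ip -et -ey; ring.
have hq : it x * E + x 0 iY2 * m * (nZ2 x' - nZ2 x) - (it x - 1) * (nZ2 x' - nZ2 x) = 0.
  apply: (eq_by_sub (w := iq x' - iq x)); last by rewrite eq subrr.
  by rewrite /iq /iu -et -ey /E /m; field.
have hr : x 0 iY2 * E - (it x - 1) * (nY4 x' - nY4 x) +
    x 0 iY2 * m * (nY4 x' - nY4 x) = 0.
  apply: (eq_by_sub (w := (ir x' - ir x) - (ip x' - ip x) +
    n * (it x * (nY4 x' - nY4 x) - x 0 iY2 * (nZ2 x' - nZ2 x)))).
    by rewrite /ir /iu -et -ey /E /m /n; field.
  by rewrite er ep hp !subrr mulr0 addr0.
have bZ : b * it x = nZ2 x' - nZ2 x.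
  apply: (eq_by_sub (w := - (it x * E + x 0 iY2 * m * (nZ2 x' - nZ2 x) -
    (it x - 1) * (nZ2 x' - nZ2 x)) -
    m * (it x * (nY4 x' - nY4 x) - x 0 iY2 * (nZ2 x' - nZ2 x)))).
    by rewrite /b /orb_b -/m -/E; ring.
  by rewrite hq hp mulr0 oppr0 addr0.
have bY : b * x 0 iY2 = nY4 x' - nY4 x.
  apply: (eq_by_sub (w := - (x 0 iY2 * E - (it x - 1) * (nY4 x' - nY4 x) +
    x 0 iY2 * m * (nY4 x' - nY4 x)) -
    (it x * (nY4 x' - nY4 x) - x 0 iY2 * (nZ2 x' - nZ2 x)))).
    by rewrite /b /orb_b -/m -/E; ring.
  by rewrite hr hp oppr0 addr0.
have bE : E = b * (it x - 1 - x 0 iY2 * m).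
  rewrite mulrBr mulrBr mulr1 mulrA bZ bY /b /orb_b -/m -/E; ring.
rewrite /orb_elt; apply: ncoord_ext; rewrite !act_coord //.
- by rewrite /orb_c; ring.
- by rewrite /orb_d; ring.
- apply: (eq_by_sub (w := - (E - b * (it x - 1 - x 0 iY2 * m)))).
    by rewrite /orb_a -/b -/m /E /it; ring.
  by rewrite -bE subrr oppr0.
- by rewrite -/b bY; ring.
- rewrite /orb_a -/b -/m -/(it x).
  apply: (eq_by_sub (w := b / 2 * (b * it x - (nZ2 x' - nZ2 x)))).
    by rewrite /m; field.
  by rewrite bZ subrr mulr0.
- by rewrite -/b -/(it x) bZ; ring.
Qed.

Lemma quot_mapP x x' : quot_map x = quot_map x' <-> exists2 l, VH C l & act l x = x'.
Proof.
split=> [e|[l Hl <-]]; last first.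
  by rewrite /quot_map it_act // iY2_act // ip_act // iq_act // ir_act.
have E (i : 'I_5) : nth 0 [:: it x; x 0 iY2; ip x; iq x; ir x] i =
    nth 0 [:: it x'; x' 0 iY2; ip x'; iq x'; ir x'] i.
  by have /rowP/(_ i) := e; rewrite !mxE.
exists (orb_elt x x'); first exact: VH_orb_elt.
apply: act_orb_elt.
- exact: (E (@Ordinal 5 0 isT)).
- exact: (E (@Ordinal 5 1 isT)).
- exact: (E (@Ordinal 5 2 isT)).
- exact: (E (@Ordinal 5 3 isT)).
- exact: (E (@Ordinal 5 4 isT)).
Qed.

Lemma VH_free : free_action (VH C) (gone C, gone C) act.
Proof.
move=> l x Hl lx; rewrite -(orb_elt_act x Hl) lx /orb_elt /orb_c /orb_d.
have b0 : orb_b x x = 0 by rewrite /orb_b; ring.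
have a0 : orb_a x x = 0 by rewrite /orb_a b0; ring.
by rewrite a0 b0 /gone; congr pair; apply: row8_ext; rewrite !mxE /=; ring.
Qed.

End ExampleCoordinates.

(** * The Lie algebra: bracket axioms, nilpotency, subalgebras *)

Section LieCommutator.
Variables (K : fieldType) (g : vectType K) (br : g -> g -> g).
Hypothesis br_lie : is_lie_bracket br.

Lemma lie_comm_sub (U W P : {vspace g}) :
  (forall u w, u \in U -> w \in W -> br u w \in P) -> (lie_comm br U W <= P)%VS.
Proof.
move=> h; apply/span_subvP => _ /allpairsP[[u w] /= [hu hw ->]].
by apply: h; apply: vbasis_mem.
Qed.

Lemma mem_lie_comm (U W : {vspace g}) u w :
  u \in U -> w \in W -> br u w \in lie_comm br U W.
Proof.
move=> uU wW; have br0l z : br 0 z = 0.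
  by have := lie_linl br_lie 1 0 0 z; rewrite scaler0 addr0 scale1r => /eqP;
    rewrite -subr_eq subrr eq_sym => /eqP.
have br0r z : br z 0 = 0.
  by have := lie_linr br_lie 1 0 0 z; rewrite scaler0 addr0 scale1r => /eqP;
    rewrite -subr_eq subrr eq_sym => /eqP.
have basis u' w' : u' \in vbasis U -> w' \in vbasis W -> br u' w' \in lie_comm br U W.
  by move=> hu hw; apply: memv_span; apply/allpairsP; exists (u', w').
have {}basis u' : u' \in vbasis U -> br u' w \in lie_comm br U W.
  move=> hu; rewrite (coord_vbasis wW); elim/big_rec: _ => [|i v _ hv].
    by rewrite br0r mem0v.
  by rewrite (lie_linr br_lie) rpredD // rpredZ // basis // mem_nth // size_tuple.
rewrite (coord_vbasis uU); elim/big_rec: _ => [|i v _ hv]; first by rewrite br0l mem0v.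
by rewrite (lie_linl br_lie) rpredD // rpredZ // basis // mem_nth // size_tuple.
Qed.

End LieCommutator.

Section ExampleLieAlgebra.
Variable C : numClosedFieldType.
Local Notation g := 'rV[C]_8.

Lemma coordD (x y : g) i : (x + y) 0 i = x 0 i + y 0 i.
Proof. exact: mxE. Qed.

Lemma coordZ (a : C) (x : g) i : (a *: x) 0 i = a * x 0 i.
Proof. exact: mxE. Qed.

Lemma coord0 i : (0 : g) 0 i = 0.
Proof. exact: mxE. Qed.

Lemma br_is_lie_bracket : is_lie_bracket (g := 'rV[C]_8) br.
Proof.
split=> [a x y z|a x y z|x|x y z].
- apply: row8_ext; rewrite (coordD (a *: br x z)) (coordZ a (br x z)) !brE /= /wedge;
    rewrite ?(coordD (a *: x)) ?(coordZ a x); ring.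
- apply: row8_ext; rewrite (coordD (a *: br z x)) (coordZ a (br z x)) !brE /= /wedge;
    rewrite ?(coordD (a *: x)) ?(coordZ a x); ring.
- by apply: row8_ext; rewrite coord0 brE /= /wedge; ring.
- apply: row8_ext; rewrite (coordD (br x (br y z) + br y (br z x)));
    rewrite (coordD (br x (br y z))) coord0 !brE /= /wedge ?brE /= /wedge; ring.
Qed.

(** Contains the derived algebra. It is not the centre, since [X_2, Z_2] = Z_1. *)
Let center1 : {vspace g} := <<[:: vec C iY3; vec C iY4; vec C iZ1; vec C iZ2]>>%VS.

Lemma mem_derived (x : g) : x \in center1 ->
  [/\ x 0 iX1 = 0, x 0 iX2 = 0, x 0 iY1 = 0 & x 0 iY2 = 0].
Proof.
rewrite /center1 !span_cons span_nil.
move=> /memv_addP[_ /vlineP[a ->] [x1 + ->]].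
move=> /memv_addP[_ /vlineP[b ->] [x2 + ->]].
move=> /memv_addP[_ /vlineP[c ->] [x3 + ->]].
move=> /memv_addP[_ /vlineP[d ->] [x4 + ->]].
rewrite memv0 => /eqP ->.
by split; rewrite !mxE /=; ring.
Qed.

Lemma br_derived (x y : g) : br x y \in center1.
Proof.
rewrite /br /center1; have m i : i \in [:: iY3; iY4; iZ1; iZ2] -> vec C i \in center1.
  move=> hi; apply: memv_span; rewrite (_ : [:: _; _; _; _] = map (vec C) [:: iY3; iY4; iZ1; iZ2]) //.
  exact: map_f.
by rewrite !rpredD // ?rpredZ ?rpredD ?m.
Qed.

Lemma br_nilpotent : nilpotent_step (g := 'rV[C]_8) br 3.
Proof.
have L1 : (lcs (g := 'rV[C]_8) br 1 <= center1)%VS.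
  by apply: lie_comm_sub => u w _ _; exact: br_derived.
have L2 : (lcs (g := 'rV[C]_8) br 2 <= <[vec C iZ1]>)%VS.
  apply: lie_comm_sub => u w _ /(subvP L1)/mem_derived[w1 w2 w3 w4].
  apply/vlineP; exists (u 0 iX2 * w 0 iZ2).
  by apply: row8_ext; rewrite brE /= /wedge ?w1 ?w2 ?w3 ?w4 !mxE /=; ring.
split.
  apply/eqP; rewrite -subv0; apply: lie_comm_sub => u w _ /(subvP L2)/vlineP[c ->].
  rewrite memv0; apply/eqP; apply: row8_ext; rewrite brE /= /wedge !mxE /=; ring.
(* The chain X_2, Y_1, Y_3 + Z_2, Z_1 of iterated brackets with X_2 keeps the first terms of the
   series nonzero. *)
have Y3Z2 : vec C iY3 + vec C iZ2 \in lcs (g := 'rV[C]_8) br 1.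
  have -> : vec C iY3 + vec C iZ2 = br (vec C iX2) (vec C iY1).
    by apply: row8_ext; rewrite coordD brE /= /wedge !mxE /=; ring.
  by apply: (mem_lie_comm br_is_lie_bracket); exact: memvf.
have Z1 : vec C iZ1 \in lcs (g := 'rV[C]_8) br 2.
  have -> : vec C iZ1 = br (vec C iX2) (vec C iY3 + vec C iZ2).
    by apply: row8_ext; rewrite brE /= /wedge !mxE /=; ring.
  by apply: (mem_lie_comm br_is_lie_bracket) => //; exact: memvf.
have nz (x : g) i : x 0 i = 1 -> x != 0.
  by move=> x1; apply/eqP => x0; move/eqP: x1; rewrite x0 coord0 eq_sym oner_eq0.
move=> [|[|[|//]]] _ l0.
- have := memvf (vec C iX1); rewrite -[fullv]/(lcs (g := 'rV[C]_8) br 0) l0 memv0.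
  by apply/negP; apply: (nz _ iX1); rewrite mxE.
- move: Y3Z2; rewrite l0 memv0; apply/negP; apply: (nz _ iY3).
  by rewrite !mxE /= addr0.
- by move: Z1; rewrite l0 memv0; apply/negP; apply: (nz _ iZ1); rewrite mxE.
Qed.

Lemma hh_subalgebra : is_subalgebra br (hh C).
Proof.
move=> x y /mem_hh[a [b ->]] /mem_hh[c [d ->]].
have -> : br (hel a b) (hel c d) = 0.
  by apply: row8_ext; rewrite brE /= /wedge !mxE /=; ring.
exact: mem0v.
Qed.

Lemma vv_subalgebra : is_subalgebra br (vv C).
Proof.
move=> x y /mem_vv[a [b ->]] /mem_vv[c [d ->]].
have -> : br (vel a b) (vel c d) = 0.
  by apply: row8_ext; rewrite brE /= /wedge !mxE /=; ring.
exact: mem0v.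
Qed.

End ExampleLieAlgebra.

Ltac polyfun_tac := repeat first
  [ exact: polyfun_cst | exact: polyfun_coord | apply: polyfunX | apply: polyfunB
  | apply: polyfunD | apply: polyfunN | apply: polyfunM ].

(** * The quotient as an open subset of a quadric *)

Section ExampleQuotient.
Variable C : numClosedFieldType.
Local Notation g := 'rV[C]_8.
Implicit Types (x : g) (y : 'rV[C]_5).

Definition jt : 'I_5 := @Ordinal 5 0 isT.
Definition js : 'I_5 := @Ordinal 5 1 isT.
Definition jp : 'I_5 := @Ordinal 5 2 isT.
Definition jq : 'I_5 := @Ordinal 5 3 isT.
Definition jr : 'I_5 := @Ordinal 5 4 isT.

Lemma ord5P (P : 'I_5 -> Prop) : P jt -> P js -> P jp -> P jq -> P jr -> forall i, P i.
Proof.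
move=> h1 h2 h3 h4 h5 [i hi]; case: i hi => [|[|[|[|[|//]]]]] hi.
- by rewrite (_ : Ordinal hi = jt) //; exact/val_inj.
- by rewrite (_ : Ordinal hi = js) //; exact/val_inj.
- by rewrite (_ : Ordinal hi = jp) //; exact/val_inj.
- by rewrite (_ : Ordinal hi = jq) //; exact/val_inj.
- by rewrite (_ : Ordinal hi = jr) //; exact/val_inj.
Qed.

Lemma ord3P (P : 'I_3 -> Prop) : P (@Ordinal 3 0 isT) -> P (@Ordinal 3 1 isT) ->
  P (@Ordinal 3 2 isT) -> forall i, P i.
Proof.
move=> h1 h2 h3 [i hi]; case: i hi => [|[|[|//]]] hi.
- by rewrite (_ : Ordinal hi = @Ordinal 3 0 isT) //; exact/val_inj.
- by rewrite (_ : Ordinal hi = @Ordinal 3 1 isT) //; exact/val_inj.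
- by rewrite (_ : Ordinal hi = @Ordinal 3 2 isT) //; exact/val_inj.
Qed.

Definition quadric : set 'rV[C]_5 :=
  [set y | y 0 jt * y 0 jr - y 0 js * y 0 jq - y 0 jp * (2 - y 0 jp) * 2^-1 = 0].

Definition chart (i : 'I_3) y : C := nth 0 [:: y 0 jt; y 0 js; 2 - y 0 jp] i.

(* The three sections normalize nZ2 = 0, nY4 = 0 and nZ2 - iu - nY4 nZ2 / 2 = 0
   respectively; the last function is a slice on the locus ip <> 2, since it grows
   linearly with slope 1 - ip / 2 along the orbits. *)
Definition section_at (i : 'I_3) y : g :=
  let Z := 2 * y 0 jq * (2 - y 0 jp)^-1 in
  let Y := 2 * y 0 jr * (2 - y 0 jp)^-1 in
  nth 0 [::
    row8 0 0 (y 0 jt - 1) (y 0 js) (y 0 jq * (y 0 jt)^-1) (y 0 jp * (y 0 jt)^-1) 0 0;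
    row8 0 0 (y 0 jt - 1) (y 0 js) ((y 0 jr - y 0 jp) * (y 0 js)^-1) 0 0
      (- y 0 jp * (y 0 js)^-1);
    row8 0 0 (y 0 jt - 1) (y 0 js) (Z * (1 - Y * 2^-1)) Y 0 Z] i.

Lemma polyfun_it : polyfun (@it C).
Proof. by rewrite /it; polyfun_tac. Qed.

Lemma polyfun_nZ2 : polyfun (@nZ2 C).
Proof. by rewrite /nZ2; polyfun_tac. Qed.

Lemma polyfun_nY4 : polyfun (@nY4 C).
Proof. by rewrite /nY4; polyfun_tac. Qed.

Lemma polyfun_nY3 : polyfun (@nY3 C).
Proof. by rewrite /nY3; polyfun_tac. Qed.

Lemma polyfun_nZ1 : polyfun (@nZ1 C).
Proof. by rewrite /nZ1; polyfun_tac. Qed.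

Lemma polyfun_ip : polyfun (@ip C).
Proof. by rewrite /ip /it /nY4 /nZ2; polyfun_tac. Qed.

Lemma polyfun_iq : polyfun (@iq C).
Proof. by rewrite /iq /iu /it /nY3 /nZ1 /nZ2; polyfun_tac. Qed.

Lemma polyfun_ir : polyfun (@ir C).
Proof. by rewrite /ir /iu /ip /it /nY3 /nY4 /nZ1 /nZ2; polyfun_tac. Qed.

Lemma quot_mapE x : [/\ quot_map x 0 jt = it x, quot_map x 0 js = x 0 iY2,
  quot_map x 0 jp = ip x, quot_map x 0 jq = iq x & quot_map x 0 jr = ir x].
Proof. by split; rewrite mxE. Qed.

Lemma polyfun_quot_map j : polyfun (fun x => quot_map x 0 j).
Proof.
elim/ord5P: j.
- by rewrite (_ : (fun _ => _) = @it C); [exact: polyfun_it|apply/funext => x; rewrite mxE].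
- by rewrite (_ : (fun _ => _) = fun x => x 0 iY2); [exact: polyfun_coord|apply/funext => x; rewrite mxE].
- by rewrite (_ : (fun _ => _) = @ip C); [exact: polyfun_ip|apply/funext => x; rewrite mxE].
- by rewrite (_ : (fun _ => _) = @iq C); [exact: polyfun_iq|apply/funext => x; rewrite mxE].
- by rewrite (_ : (fun _ => _) = @ir C); [exact: polyfun_ir|apply/funext => x; rewrite mxE].
Qed.

Lemma zclosed_quadric : zclosed quadric.
Proof. by apply: zclosed_eq0; polyfun_tac. Qed.

Lemma polyfun_chart i : polyfun (chart i).
Proof. by elim/ord3P: i; rewrite /chart /=; polyfun_tac. Qed.

Lemma quot_map_quasi_affine x : quasi_affine quadric chart (quot_map x).
Proof.
have [e1 e2 e3 e4 e5] := quot_mapE x; split; rewrite /quadric /chart /=.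
  by rewrite e1 e2 e3 e4 e5 /ir /iq /ip; field.
have [t0|t0] := eqVneq (it x) 0; last by exists (@Ordinal 3 0 isT); rewrite /= e1.
have [s0|s0] := eqVneq (x 0 iY2) 0; last by exists (@Ordinal 3 1 isT); rewrite /= e2.
(* Where t = y_2 = 0 the invariant [ip] vanishes, so the third chart function takes the value 2. *)
by exists (@Ordinal 3 2 isT); rewrite /= e3 /ip t0 s0 !mul0r !subr0 pnatr_eq0.
Qed.

Lemma regular_section_at i j :
  regular (quadric `&` [set y | chart i y != 0]) (fun y => section_at i y 0 j).
Proof.
have V k : regular (quadric `&` [set y | chart k y != 0]) (fun y => (chart k y)^-1).
  by apply: regularV; [apply/regular_polyfun/polyfun_chart|move=> y []].
have V0 := V (@Ordinal 3 0 isT); have V1 := V (@Ordinal 3 1 isT).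
have V2 := V (@Ordinal 3 2 isT); rewrite /chart /= in V0 V1 V2.
elim/ord3P: i; rewrite /section_at /chart /=; elim/ord8P: j;
  set U := (X in regular X _); under eq_fun do rewrite mxE /=.
all: repeat first [ by apply: regular_polyfun; polyfun_tac | exact: V0 | exact: V1
  | exact: V2 | apply: regularM | apply: regularB ].
Qed.

Lemma quot_map_row8 (a b u v w : C) :
  quot_map (row8 0 0 a b u v 0 w) = \row_(j < 5) nth 0
    [:: a + 1; b; (a + 1) * v - b * w; (a + 1) * u + b * w ^+ 2 / 2 - a * w;
        b * u - a * v + b * v * w - (a + 1) * v ^+ 2 / 2 + ((a + 1) * v - b * w)] j.
Proof.
by apply/rowP; elim/ord5P; rewrite /quot_map /iq /ir /iu /ip /it /nY3 /nY4 /nZ1 /nZ2;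
  rewrite !mxE /=; field.
Qed.

Lemma section_atK i y : quadric y -> chart i y != 0 -> quot_map (section_at i y) = y.
Proof.
rewrite /quadric /=; set t := y 0 jt; set s := y 0 js; set p := y 0 jp.
set q := y 0 jq; set r := y 0 jr => Qy.
have Er : t * r = s * q + p * (2 - p) * 2^-1.
  by apply/eqP; rewrite -subr_eq0 opprD addrA; apply/eqP.
have Eq : s * q = t * r - p * (2 - p) * 2^-1 by rewrite Er addrK.
have n2 : (2 : C) != 0 by rewrite pnatr_eq0.
have yE (z : 'rV[C]_5) : z 0 jt = t -> z 0 js = s -> z 0 jp = p -> z 0 jq = q ->
    z 0 jr = r -> z = y.
  by move=> *; apply/rowP; elim/ord5P.
elim/ord3P: i; rewrite /chart /section_at /= -/t -/s -/p -/q -/r => y0;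
  rewrite quot_map_row8; apply: yE; rewrite mxE /=.
- by ring.
- by [].
- by field.
- by field.
- by apply: (mulfI y0); rewrite Er; field.
- by ring.
- by [].
- by field.
- by apply: (mulfI y0); rewrite Eq; field.
- by field.
- by ring.
- by [].
all: set Y := 2 * r / (2 - p); set Z := 2 * q / (2 - p).
(* Multiplied by 2 - p, the claim tY - sZ = p is twice the equation of the quadric. *)
all: have pE : (t - 1 + 1) * Y - s * Z = p by
  (apply: (mulfI y0); transitivity (2 * (t * r) - 2 * (s * q));
    [rewrite /Y /Z; field|rewrite Er; field]).
- exact: pE.
- transitivity (Z * (1 - ((t - 1 + 1) * Y - s * Z) / 2)); first by field.
  by rewrite pE /Z; field.
- transitivity (Y * (1 - ((t - 1 + 1) * Y - s * Z) / 2)); first by field.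
  by rewrite pE /Y; field.
Qed.

Lemma quot_map_geometric_quotient :
  @geometric_quotient C (g * g) (zariski [set: g]) (VH C) act
    (zariski (quasi_affine quadric chart)) (@quot_map C).
Proof.
apply: (geometric_quotient_of_sections (s := section_at)).
- exact: zclosed_quadric.
- exact: polyfun_chart.
- exact: polyfun_quot_map.
- exact: quot_map_quasi_affine.
- exact: regular_section_at.
- exact: section_atK.
- exact: quot_mapP.
Qed.

End ExampleQuotient.

(** * Properness of the action *)

Section ContinuousFunctions.
Variables (R : realType) (T : topologicalType).
Local Notation C := (Cplx R).
Implicit Types f h : T -> C.

Lemma cont_cst (c : C) : continuous (fun _ : T => c).
Proof. by move=> t; exact: cst_continuous. Qed.

Lemma contD f h : continuous f -> continuous h -> continuous (fun t => f t + h t).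
Proof. by move=> cf ch t; apply: continuousD; [exact: cf|exact: ch]. Qed.

Lemma contB f h : continuous f -> continuous h -> continuous (fun t => f t - h t).
Proof. by move=> cf ch t; apply: continuousB; [exact: cf|exact: ch]. Qed.

Lemma contM f h : continuous f -> continuous h -> continuous (fun t => f t * h t).
Proof. by move=> cf ch t; apply: continuousM; [exact: cf|exact: ch]. Qed.

Lemma cont_row8 (f1 f2 f3 f4 f5 f6 f7 f8 : T -> C) :
  continuous f1 -> continuous f2 -> continuous f3 -> continuous f4 ->
  continuous f5 -> continuous f6 -> continuous f7 -> continuous f8 ->
  continuous (fun t => row8 (f1 t) (f2 t) (f3 t) (f4 t) (f5 t) (f6 t) (f7 t) (f8 t)).
Proof.
move=> c1 c2 c3 c4 c5 c6 c7 c8 t; apply: cvg_rV => i.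
rewrite mxE; under eq_fun do rewrite mxE; elim/ord8P: i => /=;
  [exact: c1|exact: c2|exact: c3|exact: c4|exact: c5|exact: c6|exact: c7|exact: c8].
Qed.

End ContinuousFunctions.

Section ExampleProper.
Variable R : realType.
Local Notation C := (Cplx R).
Local Notation g := 'rV[C]_8.

Let fst_cont : continuous (fun p : g * g => p.1).
Proof. by move=> p; exact: cvg_fst. Qed.

Let cont1 (f : g -> C) : polyfun f -> continuous (fun p : g * g => f p.1).
Proof.
move=> pf p; have cf := continuous_polyfun pf.
by apply: (@continuous_comp (g * g)%type g C fst f); [exact: cvg_fst|exact: cf].
Qed.

Let cont2 (f : g -> C) : polyfun f -> continuous (fun p : g * g => f p.2).
Proof.
move=> pf p; have cf := continuous_polyfun pf.
by apply: (@continuous_comp (g * g)%type g C snd f); [exact: cvg_snd|exact: cf].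
Qed.

Lemma continuous_orb_b : continuous (fun p : g * g => orb_b p.1 p.2).
Proof.
have y2 := cont1 (@polyfun_coord C 8 iY2).
have dZ1 := contB (cont2 (polyfun_nZ1 C)) (cont1 (polyfun_nZ1 C)).
have dZ2 := contB (cont2 (polyfun_nZ2 C)) (cont1 (polyfun_nZ2 C)).
have dY3 := contB (cont2 (polyfun_nY3 C)) (cont1 (polyfun_nY3 C)).
have dY4 := contB (cont2 (polyfun_nY4 C)) (cont1 (polyfun_nY4 C)).
have half : continuous (fun _ : g * g => 2^-1 : C) by exact: cont_cst.
have sZ2 := contM (contD (cont1 (polyfun_nZ2 C)) (cont2 (polyfun_nZ2 C))) half.
exact: contB (contB dZ2 (contM sZ2 dY4)) (contB dY3 (contM y2 dZ1)).
Qed.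

Lemma continuous_orb_a : continuous (fun p : g * g => orb_a p.1 p.2).
Proof.
have dZ1 := contB (cont2 (polyfun_nZ1 C)) (cont1 (polyfun_nZ1 C)).
have half : continuous (fun _ : g * g => 2^-1 : C) by exact: cont_cst.
have sZ2 := contM (contD (cont1 (polyfun_nZ2 C)) (cont2 (polyfun_nZ2 C))) half.
exact: contB dZ1 (contM continuous_orb_b sZ2).
Qed.

Lemma continuous_orb_elt : continuous (fun p : g * g => orb_elt p.1 p.2).
Proof.
have c1 i := cont1 (@polyfun_coord C 8 i); have c2 i := cont2 (@polyfun_coord C 8 i).
have z : continuous (fun _ : g * g => 0 : C) by exact: cont_cst.
have ca := continuous_orb_a; have cb := continuous_orb_b.
have cc := contB (contD (c1 iX1) ca) (c2 iX1).
have cd := contB (contD (c1 iX2) cb) (c2 iX2).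
have cv := cont_row8 ca cb z z z z ca cb; have ch := cont_row8 cc cd z z z z z z.
by move=> p; exact: (cvg_pair (cv p) (ch p)).
Qed.

Lemma continuous_quot_map : continuous (@quot_map C).
Proof.
move=> x; apply: (@cvg_rV _ _ (nbhs x)) => i.
exact: (continuous_polyfun (polyfun_quot_map C i)).
Qed.

Lemma VH_proper : proper_action (VH C) act.
Proof.
move=> K cK; pose E := [set p : g * g | quot_map p.1 = quot_map p.2].
have cE : closed E.
  rewrite (_ : E = (fun p : g * g => quot_map p.1 - quot_map p.2) @^-1` [set 0]).
    apply: preimage_closed; last first.
      by apply: accessible_closed_set1; apply: hausdorff_accessible; exact: norm_hausdorff.
    have c1 : continuous (fun p : g * g => quot_map p.1).
      move=> p; apply: (@continuous_comp (g * g)%type g 'rV[C]_5 fst (@quot_map C)).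
        exact: cvg_fst.
      exact: continuous_quot_map.
    have c2 : continuous (fun p : g * g => quot_map p.2).
      move=> p; apply: (@continuous_comp (g * g)%type g 'rV[C]_5 snd (@quot_map C)).
        exact: cvg_snd.
      exact: continuous_quot_map.
    by move=> p _; exact: (continuousB (c1 p) (c2 p)).
  rewrite predeqE => p; split=> [h|].
    by rewrite /preimage /= (h : quot_map p.1 = quot_map p.2) subrr.
  by move=> /eqP; rewrite subr_eq0 => /eqP.
(* The group element is a continuous function of the pair (x, x'), so the preimage of [K] is a
   continuous image of the compact set K ∩ E, where E is the closed locus of equal invariants. *)
rewrite (_ : mkset _ =
    (fun p : g * g => (orb_elt p.1 p.2, p.1)) @` (K `&` E)).
  apply: continuous_compact; last exact: compact_closedI.
  apply: continuous_subspaceT => p.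
  exact: (cvg_pair (@continuous_orb_elt p) (@fst_cont p)).
rewrite predeqE => -[l x]; split=> /=.
  move=> [Hl Kx]; exists (x, act l x); last by rewrite /= orb_elt_act.
  by split=> //; apply/quot_mapP; exists l.
move=> [[x1 x2] [Kx Ex] [<- <-]]; have [l' Hl' e] := (quot_mapP x1 x2).1 Ex.
by rewrite /= -e in Kx *; rewrite orb_elt_act.
Qed.

End ExampleProper.

(** * Invariant functions near the missing point *)

Section InvariantFunctions.
Variable R : realType.
Local Notation C := (Cplx R).
Local Notation g := 'rV[C]_8.
Implicit Types (t y : C).

(* Two points of the same orbit when t and y are nonzero: pt1 is continuous across
   y = 0, while pt2 is affine, hence holomorphic, in t across t = 0. *)
Definition pt1 t y : g := row8 0 0 (t - 1) y 0 (2 * t^-1) 0 0.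
Definition pt2 t y : g := row8 0 0 (t - 1) y (- 2 * y^-1) 0 0 (- 2 * y^-1).

(** Both points have the invariants (t, y, 2, 0, 0). *)
Lemma pt2_orbit_pt1 t y : t != 0 -> y != 0 ->
  exists2 l, VH C l & act l (pt2 t y) = pt1 t y.
Proof.
move=> t0 y0; apply/quot_mapP; rewrite !quot_map_row8; apply/rowP.
by elim/ord5P; rewrite !mxE /=; field; rewrite ?t0 ?y0.
Qed.

Lemma pt2_line t y : pt2 t y = t *: vec C iY1 + pt2 0 y.
Proof. by apply: row8_ext; rewrite !mxE /=; ring. Qed.

(** For j < 4 and |s| <= 1 these points fill the boundary of the square in [square_bound], which
    avoids t = 0. *)
Definition edge j (s : R) : C := (0 +i* 1)%C ^+ j * (1 +i* s)%C.

Lemma edge_neq0 j s : edge j s != 0.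
Proof.
rewrite mulf_neq0 ?expf_neq0 //; apply/eqP => /(congr1 (@nc R)).
  by rewrite nc0 /nc /= expr0n /= add0r expr1n sqrtr1 => /eqP; rewrite oner_eq0.
by move=> /eqP; rewrite nc0 nc_eq0 eq_complex /= oner_eq0.
Qed.

Lemma continuous_pt1_edge j :
  continuous (fun p : R * R => pt1 (edge j p.1) (p.2 +i* 0)%C).
Proof.
have z : continuous (fun _ : R * R => 0 : C) by exact: cont_cst.
have o : continuous (fun _ : R * R => 1 : C) by exact: cont_cst.
have two : continuous (fun _ : R * R => 2 : C) by exact: cont_cst.
have Jj : continuous (fun _ : R * R => (0 +i* 1)%C ^+ j : C) by exact: cont_cst.
have c1 : continuous (fun p : R * R => (1 +i* p.1)%C : C).
  move=> p.
  apply: (@continuous_comp (R * R)%type (R * R)%type C (fun q : R * R => (1, q.1))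
    (fun q : R * R => (q.1 +i* q.2)%C : C)); last exact: complex_continuous.
  have k1 : (fun _ : R * R => 1 : R) @ p --> (1 : R) by exact: cvg_cst.
  have k2 : (fun q : R * R => q.1) @ p --> p.1 by exact: cvg_fst.
  exact: (cvg_pair k1 k2).
have c2 : continuous (fun p : R * R => (p.2 +i* 0)%C : C).
  move=> p.
  apply: (@continuous_comp (R * R)%type (R * R)%type C (fun q : R * R => (q.2, 0))
    (fun q : R * R => (q.1 +i* q.2)%C : C)); last exact: complex_continuous.
  have k1 : (fun _ : R * R => 0 : R) @ p --> (0 : R) by exact: cvg_cst.
  have k2 : (fun q : R * R => q.2) @ p --> p.2 by exact: cvg_snd.
  exact: (cvg_pair k2 k1).
have ce : continuous (fun p : R * R => edge j p.1) := contM Jj c1.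
have ci : continuous (fun p : R * R => (edge j p.1)^-1).
  by move=> p; apply: cvgV; [exact: edge_neq0|exact: ce].
exact: (cont_row8 z z (contB ce o) c2 z (contM two ci) z z).
Qed.

(** On the boundary of the square, [f] may be evaluated at [pt1], where compactness bounds it
    uniformly for y in [0, 1], the value 0 included. For fixed y ≠ 0 the function t |-> f (pt2 t y)
    is entire, so [square_bound] carries the bound to t = 0. *)
Lemma invariant_bounded (f : g -> C) : (forall x, ldiff f x) ->
  (forall l x, VH C l -> f (act l x) = f x) ->
  exists M, forall k, nc (f (pt2 0 (real_complex R k.+1%:R^-1))) <= M.
Proof.
move=> df inv.
have B j : exists M : R, forall s r : R, `|s| <= 1 -> 0 <= r <= 1 ->
    nc (f (pt1 (edge j s) (r +i* 0)%C)) <= M.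
  pose A : set (R * R) := `[- 1, 1]%classic `*` `[0, 1]%classic.
  have cA : compact A by apply: compact_setX; exact: segment_compact.
  have A0 : A !=set0 by exists (0, 0); split; rewrite /= in_itv /= ?lexx ?ler01 ?oppr_le0 ?ler01.
  pose h (p : R * R) := nc (f (pt1 (edge j p.1) (p.2 +i* 0)%C)).
  have ch : continuous h.
    move=> p; apply: (@continuous_comp (R * R)%type C R (fun p : R * R => f (pt1 (edge j p.1) (p.2 +i* 0)%C)) (@nc R));
      last exact: nc_continuous.
    apply: (@continuous_comp (R * R)%type g C (fun p : R * R => pt1 (edge j p.1) (p.2 +i* 0)%C) f); first exact: continuous_pt1_edge.
    exact: ldiff_continuous.
  have [c _ hc] := compact_EVT_max A0 cA (continuous_subspaceT ch).
  exists (h c) => s r hs hr; apply: (hc (s, r)); rewrite inE; split=> /=.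
    by rewrite in_itv /= -ler_norml.
  by rewrite in_itv.
have [M0 h0] := B 0; have [M1 h1] := B 1; have [M2 h2] := B 2; have [M3 h3] := B 3.
pose M := `|M0| + `|M1| + `|M2| + `|M3|.
exists (2 * M) => k; set y := real_complex R k.+1%:R^-1.
have y0 : y != 0 by rewrite fmorph_eq0 invr_eq0 pnatr_eq0.
have hr : 0 <= (k.+1%:R^-1 : R) <= 1.
  by rewrite invr_ge0 ler0n /= invf_le1 ?ltr0n // ler1n.
pose phi t := f (pt2 t y).
have dphi t : differentiable phi t.
  have -> : phi = (fun s => f (s *: vec C iY1 + pt2 0 y)).
    by apply/funext => s; rewrite /phi pt2_line.
  by apply: ldiff_line.
apply: (square_bound dphi) => j s j4 hs; rewrite -/(edge j s) /phi.
have [l Hl e] := pt2_orbit_pt1 (edge_neq0 j s) y0; rewrite -(inv l) // e.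
have n0 := normr_ge0 M0; have n1 := normr_ge0 M1; have n2 := normr_ge0 M2.
have n3 := normr_ge0 M3; have l0 := ler_norm M0; have l1 := ler_norm M1.
have l2 := ler_norm M2; have l3 := ler_norm M3.
case: j j4 {l Hl e} => [|[|[|[|//]]]] _.
- by have := h0 s _ hs hr; rewrite /M; lra.
- by have := h1 s _ hs hr; rewrite /M; lra.
- by have := h2 s _ hs hr; rewrite /M; lra.
- by have := h3 s _ hs hr; rewrite /M; lra.
Qed.

Lemma cvg_inv_nat : (fun k => real_complex R k.+1%:R^-1 : C) @ \oo --> (0 : C).
Proof.
apply/(@cvgrPdist_lt _ C _ \oo) => e e0.
have eE : e = real_complex R (re e) by rewrite RRe_real //; exact: gtr0_real.
have re0 : 0 < re e by rewrite -ltr0C -eE.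
have h := near_infty_natSinv_lt (PosNum re0).
apply: filterS h => k hk; rewrite sub0r normrN eE normE ltcR /nc /= expr0n /= addr0.
by rewrite sqrtr_sqr ger0_norm // invr_ge0.
Qed.

(* The points pt2 0 (1/k) have no limit in the quotient: it, x_Y2 and ip tend to
   0, 0 and 2 along them, values not taken simultaneously on G. *)
Lemma no_separating_map n (F : g -> 'rV[C]_n) (Z : set 'rV[C]_n)
    (T1 T2 T3 : 'rV[C]_n -> C) :
  (forall i x, ldiff (fun x => F x 0 i) x) ->
  (forall l x, VH C l -> F (act l x) = F x) ->
  closed Z -> (forall x, Z (F x)) -> (forall z, Z z -> exists x, F x = z) ->
  regular Z T1 -> regular Z T2 -> regular Z T3 ->
  (forall x, T1 (F x) = it x) -> (forall x, T2 (F x) = x 0 iY2) ->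
  (forall x, T3 (F x) = ip x) -> False.
Proof.
move=> dF inv cZ ZF surj r1 r2 r3 e1 e2 e3.
pose u k := F (pt2 0 (real_complex R k.+1%:R^-1)).
have /choice[M hM] i : exists M, forall k, nc (u k 0 i) <= M.
  by apply: (@invariant_bounded (fun x => F x 0 i)) => // l x Hl; rewrite inv.
pose N := \sum_i `|M i|.
have uN k i : nc (u k 0 i) <= N.
  apply: le_trans (hM i k) _; apply: le_trans (ler_norm _) _.
  by rewrite /N (bigD1 i) //= lerDl sumr_ge0.
have uP : (u @ \oo) [set v : 'rV[C]_n | forall i, nc (v 0 i) <= N].
  by apply: (@filterE _ \oo) => k i; exact: uN.
have [c [_]] := @compact_polydisc R n N (u @ \oo) _ uP.
(* [G] refines the filter of the sequence [u] and converges to [c], which replaces the extraction of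
   a subsequence. *)
rewrite cluster_cvgE => -[G PG [Gc uG]].
have GZ : G Z by apply: uG; apply: (@filterE _ \oo) => k; exact: ZF.
have Zc : Z c.
  apply: cZ => B nB; apply: (@filter_ex _ G); apply: filterI => //; exact: Gc.
have lim T (a : C) : regular Z T -> (T \o u) @ \oo --> a -> T c = a.
  move=> rT Ta; have := regular_cvg _ rT Zc GZ Gc => /(_ _).
  have Ta' : T @ G --> a by move=> B /Ta h; exact: uG h.
  have PT : ProperFilter (T @ G) by exact: fmap_proper_filter.
  move=> Tc; exact: (@norm_cvg_unique C C (T @ G) PT _ _ Tc Ta').
have T1c : T1 c = 0.
  apply: lim => //; rewrite (_ : T1 \o u = fun=> 0); first exact: cvg_cst.
  by apply/funext => k; rewrite /= e1 /it mxE /=; ring.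
have T2c : T2 c = 0.
  apply: lim => //; rewrite (_ : T2 \o u = fun k => real_complex R k.+1%:R^-1).
    exact: cvg_inv_nat.
  by apply/funext => k; rewrite /= e2 mxE.
have T3c : T3 c = 2.
  apply: lim => //; rewrite (_ : T3 \o u = fun=> 2); first exact: cvg_cst.
  apply/funext => k; rewrite /= e3 /ip /it /nY4 /nZ2 !mxE /=.
  have : real_complex R k.+1%:R^-1 != 0 by rewrite fmorph_eq0 invr_eq0 pnatr_eq0.
  by move: (real_complex R _) => y y0; field.
have [x xc] := surj c Zc.
move: T3c; rewrite -xc e3 /ip -e1 -e2 xc T1c T2c !mul0r subrr => /eqP.
by rewrite eq_sym pnatr_eq0.
Qed.

End InvariantFunctions.

(** * No affine quotient and no slice *)

Lemma gmul_reassoc (C : numClosedFieldType) (v v0 s h0 h : 'rV[C]_8) :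
  gmul (gmul (gmul v v0) s) (gmul h0 h) = gmul (gmul v (gmul (gmul v0 s) h0)) h.
Proof.
have e := etrans (gmulA v (gmul v0 s) h0) (congr1 (fun z => gmul z h0) (gmulA v v0 s)).
exact (etrans (gmulA (gmul (gmul v v0) s) h0 h) (congr1 (fun z => gmul z h) (esym e))).
Qed.

Section ExampleObstruction.
Variable R : realType.
Local Notation C := (Cplx R).
Local Notation g := 'rV[C]_8.

(** The separating map is [f \o pi]. The invariants descend to [Y] by the sheaf condition [gq_fun]
    and are carried to [Z] by the inverse [h] of the isomorphism. *)
Lemma quotient_not_affine (Y : funspace C) (pi : pt (Gvar R) -> pt Y) :
  geometric_quotient (X := Gvar R) (VH C) act pi -> ~ affine Y.
Proof.
move=> gq [n [Z [cZ [f [mf [h [mh hf fh]]]]]]].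
have [sY _ _] := gq_variety gq.
have [pd po pr] := gq_morphism gq; have [fd fo fr] := mf; have [hd ho hr] := mh.
have piY x : @dom C Y (pi x) by exact: pd.
have desc (T : g -> C) : polyfun T -> (forall l x, VH C l -> T (act l x) = T x) ->
    exists T' : 'rV[C]_n -> C, regular Z T' /\ forall x, T' (f (pi x)) = T x.
  move=> pT invT.
  have [||tau rtau tauE] := gq_fun gq (phi := T) (opn_dom sY).
  - exact: regular_polyfun.
  - by move=> l x Hl _; exact: invT.
  exists (tau \o h); split; last first.
    by move=> x; rewrite /= (hf _ (piY x)); apply/esym/tauE; split=> //; exact: piY.
  have := hr _ _ (opn_dom sY) rtau; apply: regular_sub => z Zz.
  by split=> //; exact: hd.
have [T1 [r1 e1]] := desc _ (polyfun_it C) (fun l x => @it_act _ l x).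
have [T2 [r2 e2]] := desc _ (@polyfun_coord C 8 iY2) (fun l x => @iY2_act _ l x).
have [T3 [r3 e3]] := desc _ (polyfun_ip C) (fun l x => @ip_act _ l x).
apply: (no_separating_map (F := f \o pi) _ _ _ _ _ r1 r2 r3 e1 e2 e3).
- move=> i x; apply: regular_ldiff.
  have oZ : @opn C (zariski Z) Z by exists setT; [exact: zopenT|rewrite setIT].
  have rc : @reg C (zariski Z) Z (fun z => z 0 i).
    by apply: regular_polyfun; exact: polyfun_coord.
  have := pr _ _ (fo _ oZ) (fr _ _ oZ rc); apply: regular_sub => y _.
  by split=> //; split; [exact: piY|exact: fd].
- move=> l x Hl /=; congr f; apply/esym/(gq_fibre gq) => //.
  by exists l.
- exact: zclosed_closed.
- by move=> x; exact: fd.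
- move=> z Zz; have [x _ xE] := gq_surj gq (hd _ Zz).
  by exists x; rewrite /= xE fh.
Qed.

Section Slice.
Variables (S : set g) (sg : g -> 'rV[C]_(8 + 8 + 8)).
Hypotheses (sgS : forall x, VSH S (sg x)) (sgK : forall x, vsh (sg x) = x).
Hypothesis vshK : forall p, VSH S p -> sg (vsh p) = p.

(** The factor s of x = vsh: a retraction of G onto [S] that is constant on orbits, used as the
    separating map. *)
Definition slice_part (x : g) : g := rsubmx (lsubmx (sg x)).

Lemma slice_part_coord x i : slice_part x 0 i = sg x 0 (lshift 8 (rshift 8 i)).
Proof. by rewrite /slice_part !mxE. Qed.

(** If x = v_0 s h_0, then v x h^-1 = (v v_0) s (h_0 h^-1), and the decomposition is unique. *)
Lemma slice_part_act l x : VH C l -> slice_part (act l x) = slice_part x.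
Proof.
move=> /VHP[a [b [c [d ->]]]].
have [/VgrpP[a0 [b0 E1]] Sx /HgrpP[c0 [d0 E3]]] := sgS x.
have xE := sgK x; rewrite /vsh E1 E3 in xE.
have vE : gmul (vel a b) (vel a0 b0) = vel (a + a0) (b + b0).
  by apply: row8_ext; rewrite gmulE /wedge !mxE /=; ring.
have hE : gmul (hel c0 d0) (ginv (hel c d)) = hel (c0 - c) (d0 - d).
  by apply: row8_ext; rewrite gmulE /wedge !mxE /=; ring.
pose p := row_mx (row_mx (vel (a + a0) (b + b0)) (slice_part x)) (hel (c0 - c) (d0 - d)).
have Sp : VSH S p.
  split; rewrite ?row_mxKl ?row_mxKr //; first by apply/VgrpP; do 2!eexists.
  by apply/HgrpP; do 2!eexists.
have pE : vsh p = act (vel a b, hel c d) x.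
  rewrite /vsh /act /= row_mxKl row_mxKr row_mxKl row_mxKr.
  rewrite -vE -hE -[X in _ = gmul (gmul _ X) _]xE.
  exact: gmul_reassoc.
have e : rsubmx (lsubmx p) = slice_part x by rewrite /p row_mxKl row_mxKr.
rewrite -pE -[RHS]e /slice_part (vshK Sp); reflexivity.
Qed.

Lemma slice_part_orbit x : exists2 l, VH C l & act l (slice_part x) = x.
Proof.
have [V1 Sx /HgrpP[c [d E3]]] := sgS x.
exists (lsubmx (lsubmx (sg x)), hel (- c) (- d)).
  by split=> //=; apply/HgrpP; do 2!eexists.
rewrite -[in RHS](sgK x) /vsh /act /= E3; congr gmul.
by apply: row8_ext; rewrite !mxE /= ?oppr0 ?opprK.
Qed.

Lemma slice_part_id s : S s -> slice_part s = s.
Proof.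
move=> Ss; pose p := row_mx (row_mx (0 : g) s) (0 : g).
have Sp : VSH S p.
  split; rewrite ?row_mxKl ?row_mxKr //.
    by apply/VgrpP; exists 0, 0; apply: row8_ext; rewrite !mxE.
  by apply/HgrpP; exists 0, 0; apply: row8_ext; rewrite !mxE.
have pE : vsh p = s.
  rewrite /vsh row_mxKl row_mxKr row_mxKl row_mxKr.
  by apply: row8_ext; rewrite !gmulE /wedge !gmulE /wedge !coord0 /=; ring.
by rewrite -{1}pE /slice_part vshK // row_mxKl row_mxKr.
Qed.

(** Since [slice_part x] lies in the orbit of x, the invariants factor through it by their own
    restrictions to [S]. *)
Lemma no_slice : closed S -> (forall i x, ldiff (fun x => slice_part x 0 i) x) -> False.
Proof.
move=> cS df.
have inv (T : g -> C) : (forall l x, VH C l -> T (act l x) = T x) ->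
    forall x, T (slice_part x) = T x.
  by move=> invT x; have [l Hl {2}<-] := slice_part_orbit x; rewrite invT.
apply: (@no_separating_map R 8 slice_part S (@it C) (fun x => x 0 iY2) (@ip C)).
- exact: df.
- exact: slice_part_act.
- exact: cS.
- by move=> x; have [] := sgS x.
- by move=> z Sz; exists z; exact: slice_part_id.
- by apply: regular_polyfun; exact: polyfun_it.
- by apply: regular_polyfun; exact: polyfun_coord.
- by apply: regular_polyfun; exact: polyfun_ip.
- by apply: inv => l x; exact: it_act.
- by apply: (inv (fun x => x 0 iY2)) => l x; exact: iY2_act.
- by apply: inv => l x; exact: ip_act.
Qed.

End Slice.

Lemma no_holomorphic_slice (S : set g) : ~ holomorphic_slice S.
Proof.
move=> [cS _ [_ _ [sg [sgS hol vshK sgK]]]].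
apply: (@no_slice S sg) => //; first by move=> x; exact: sgS.
  by move=> x; exact: sgK.
move=> i x; have [U [G [oU Ux dG UE]]] := hol x I.
exists (fun y => G y 0 (lshift 8 (rshift 8 i))).
  apply: (@differentiable_comp _ _ _ _ G (fun v => v 0 (lshift 8 (rshift 8 i)))).
    exact: dG.
  exact: differentiable_coord.
have nU : nbhs x U by exact: open_nbhs_nbhs.
by apply: (@filterS _ (nbhs x) _ _ _ _ nU) => y Uy; rewrite slice_part_coord UE.
Qed.

Lemma no_algebraic_slice (S : set g) : ~ algebraic_slice S.
Proof.
move=> [cS [mv [sg [ms vshK sgK]]]].
have sgS x : VSH S (sg x) by case: ms => h _ _; exact: h.
apply: (@no_slice S sg) => //; first by move=> x; exact: sgK.
  exact: zclosed_closed.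
move=> i x; apply: regular_ldiff.
rewrite (_ : (fun x => _) = (fun x => sg x 0 (lshift 8 (rshift 8 i)))).
  have := morphism_regular (lshift 8 (rshift 8 i)) ms; apply: regular_sub => y _.
  by split=> //; exact: sgS.
by apply/funext => y; rewrite slice_part_coord.
Qed.

End ExampleObstruction.

Theorem mainTheorem5 (R : realType) :
  [/\ is_lie_bracket (g := 'rV[Cplx R]_8) br,
      nilpotent_step (g := 'rV[Cplx R]_8) br 3,
      is_subalgebra br (hh (Cplx R)) &
      is_subalgebra br (vv (Cplx R))] /\
  [/\ free_action (VH (Cplx R)) (gone (Cplx R), gone (Cplx R)) act,
      proper_action (VH (Cplx R)) act,
      (exists (Y : funspace (Cplx R)) (pi : pt (Gvar R) -> pt Y),
         geometric_quotient (X := Gvar R) (VH (Cplx R)) act pi) /\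
      (forall (Y : funspace (Cplx R)) (pi : pt (Gvar R) -> pt Y),
         geometric_quotient (X := Gvar R) (VH (Cplx R)) act pi -> ~ affine Y),
      ~ (exists S : set 'rV[Cplx R]_8, algebraic_slice S) &
      ~ (exists S : set 'rV[Cplx R]_8, holomorphic_slice S)].
Proof.
split; split.
- exact: br_is_lie_bracket.
- exact: br_nilpotent.
- exact: hh_subalgebra.
- exact: vv_subalgebra.
- exact: VH_free.
- exact: VH_proper.
- split; last exact: quotient_not_affine.
  exists (zariski (quasi_affine (@quadric (Cplx R)) (@chart (Cplx R)))).
  by exists (@quot_map (Cplx R)); exact: quot_map_geometric_quotient.
- by move=> [S]; exact: no_algebraic_slice.
- by move=> [S]; exact: no_holomorphic_slice.
Qed.
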